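(* Let $(\Sigma,\rho,\mu)$ be a complete space of homogeneous type with a metrically continuous measure $\mu$, and let $\mathscr{B}_\rho$ be the family of all metric balls. Let $x_0\in\Sigma$, $p\in(1,\infty)$, and $w\in A_{p,\mathscr{B}_\rho}$. Then a subset $\mathcal{K}\subset L^p(\Sigma,w)$ is relatively compact in $L^p(\Sigma,w)$ if and only if the following are satisfied: (a) $\sup_{f\in\mathcal{K}}\|f\|_{L^p(\Sigma,w)}<\infty$; (b) $\lim_{A\to\infty}\sup_{f\in\mathcal{K}}\|f\mathbf{1}_{\Sigma\setminus B(x_0,A)}\|_{L^p(\Sigma,w)}=0$; (c) $\lim_{r\to0}\sup_{f\in\mathcal{K}}\|f-f_{B(\cdot,r)}\|_{L^p(\Sigma,w)}=0$.
   Context: A space of homogeneous type $(\Sigma,\rho,\mu)$ is a metric space $(\Sigma,\rho)$ with a nonnegative Borel measure $\mu$ that is doubling: $0<\mu(2B)\le C_\mu\mu(B)<\infty$ for every ball $B$, where $B(x,r)=\{y:\rho(x,y)<r\}$ and $\lambda B$ is the ball with the same center and $\lambda$ times the radius; $\mathscr{B}_\rho$ is the family of all balls. It is complete if $(\Sigma,\rho)$ is complete. $\mu$ is metrically continuous if $\lim_{y\to x}\mu(B(x,r)\Delta B(y,r))=0$ for all $x\in\Sigma$, $r>0$ ($\Delta$ is symmetric difference). A weight is a measurable $w$ with $0<w<\infty$ a.e.; $L^p(\Sigma,w):=L^p(\Sigma,w\,d\mu)$. For $1<p<\infty$, $w\in A_{p,\mathscr{B}_\rho}$ means $\sup_{B\in\mathscr{B}_\rho}(\frac1{\mu(B)}\int_Bw\,d\mu)(\frac1{\mu(B)}\int_Bw^{1-p'}d\mu)^{p-1}<\infty$.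 $f_{B(\cdot,r)}$ is the function $x\mapsto f_{B(x,r)}:=\frac1{\mu(B(x,r))}\int_{B(x,r)}f\,d\mu$. *)

(* Defs.v *)
From HB Require Import structures.
From mathcomp Require Import all_boot all_order all_algebra.
From mathcomp Require Import all_classical all_reals all_analysis.
From mathcomp Require Import measurable_realfun.

Set Implicit Arguments.
Unset Strict Implicit.
Unset Printing Implicit Defensive.

Import Order.TTheory GRing.Theory Num.Theory.
Import numFieldNormedType.Exports.

Local Open Scope classical_set_scope.
Local Open Scope ring_scope.

HB.mixin Record isBorelSpace (d : measure_display) T
    & Topological T & Measurable d T := {
  borel_measurableE : @measurable d T = <<s @open T >>
}.

#[short(type="completeBorelMetricType")]
HB.structure Definition CompleteBorelMetric (d : measure_display)
    (R : numDomainType) :=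
  {T of Metric R T & Complete T & Measurable d T & isBorelSpace d T}.

(* The library does not yet equip LspaceType with its norm topology. *)
Section LspaceMetric.
Context d (T : measurableType d) (R : realType).
Variables (mu : {measure set T -> \bar R}) (p : \bar R) (p1 : (1 <= p)%E).

HB.instance Definition _ := gen_eqMixin (LspaceType mu p1).
HB.instance Definition _ := gen_choiceMixin (LspaceType mu p1).

Definition Lspace_dist (f g : LspaceType mu p1) : R :=
  fine (Lnorm mu p (fun x => (f x - g x)%:E))%E.

Let measurable_Lspace (f : LspaceType mu p1) :
  measurable_fun [set: T] (f : T -> R).
Proof. exact: (measurable_funP (repr (LebesgueSpace.sort f))). Qed.

Let Lspace_Lfun (f : LspaceType mu p1) : (f : T -> R) \in Lfun mu p.
Proof.
apply/andP; split; rewrite inE/=; first exact: measurable_Lspace.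
exact: Lebesgue_finite.
Qed.

Let Lspace_distE (f g : LspaceType mu p1) :
  (Lspace_dist f g)%:E = Lnorm mu p (fun x => (f x - g x)%:E).
Proof.
have fg : ((f : T -> R) - (g : T -> R)) \in Lfun mu p.
    have := (Lfun_submod_closed mu p1).2 (-1) _ _ (Lspace_Lfun g) (Lspace_Lfun f).
  by rewrite scaleN1r addrC.
exact: (finite_norm_fine (Lfun_Sub p1 fg)).
Qed.

Let Lspace_distxx f : Lspace_dist f f = 0.
Proof.
rewrite /Lspace_dist (@eq_Lnorm _ _ _ _ _ _ (cst 0)) => [|x]; last first.
  by rewrite /= subrr.
by rewrite Lnorm0// gt_eqF// (lt_le_trans _ p1).
Qed.

Let Lspace_dist_eq0 f g : Lspace_dist f g = 0 -> f = g.
Proof.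
move=> fg0; have {}fg0 : Lnorm mu p (fun x => (f x - g x)%:E) = 0%E.
  by rewrite -Lspace_distE fg0.
have mfg : measurable_fun setT (EFin \o (fun x => f x - g x : R)).
  apply/measurable_EFinP/measurable_funB; exact: measurable_Lspace.
have /(Lnorm_eq0_eq0 mfg (lt_le_trans lte01 p1)) fg := fg0.
have {}fg : (LebesgueSpace.sort f : T -> R) = LebesgueSpace.sort g %[ae mu].
  by apply: filterS fg => x /(_ I)/= [/eqP]; rewrite subr_eq0 => /eqP.
have : LebesgueSpace.sort f = LebesgueSpace.sort g.
  by rewrite -[LHS]reprK -[RHS]reprK; apply/eqquotP/asboolP.
case: f g {fg0 mfg fg} => f [[Pf]] [g [[Pg]]]/= fg; subst g.
by rewrite (Prop_irrelevance Pf Pg).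
Qed.

Let Lspace_dist_sym f g : Lspace_dist f g = Lspace_dist g f.
Proof.
rewrite /Lspace_dist -oppe_Lnorm; congr fine; apply: eq_Lnorm => x.
exact: (congr1 EFin (opprB _ _)).
Qed.

Let Lspace_dist_triangle g f h :
  Lspace_dist f h <= Lspace_dist f g + Lspace_dist g h.
Proof.
rewrite -lee_fin EFinD !Lspace_distE.
have mB (u v : LspaceType mu p1) : measurable_fun setT (fun x => u x - v x : R).
  by apply: measurable_funB; exact: measurable_Lspace.
apply: le_trans (eminkowski mu (mB f g) (mB g h) p1).
by rewrite le_eqVlt (@eq_Lnorm _ _ _ _ _ _ (EFin \o ((fun x => f x - g x) \+
  (fun x => g x - h x)))) ?eqxx// => x /=; rewrite subrKA.
Qed.

HB.instance Definition _ := isMetric.Build R (LspaceType mu p1)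
  Lspace_distxx Lspace_dist_eq0 Lspace_dist_sym Lspace_dist_triangle.
End LspaceMetric.

Section Weights.
Context d (T : measurableType d) (R : realType).
Local Open Scope ereal_scope.

Definition average (mu : {measure set T -> \bar R}) (f : T -> \bar R)
    (A : set T) : \bar R :=
  (mu A)^-1 * \int[mu]_(x in A) f x.

Definition is_weight (mu : {measure set T -> \bar R})
    (w : {mfun T >-> \bar R}) : Prop :=
  {ae mu, forall x, 0 < w x < +oo}.

Definition Muckenhoupt (mu : {measure set T -> \bar R}) (p : R)
    (F : set (set T)) (w : {mfun T >-> \bar R}) : Prop :=
  let p' := fine (hoelder_conjugate p%:E) in
  ereal_sup [set average mu w B *
                 average mu (fun x => w x `^ (1 - p')%R) B `^ (p - 1)%R
            | B in F] < +oo.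

(* The measure w dmu. Taking the positive part makes it a measure for every
   measurable w; a weight differs from its positive part on a null set only. *)
Definition weighted_measure (mu : {measure set T -> \bar R})
    (w : {mfun T >-> \bar R}) (A : set T) : \bar R :=
  \int[mu]_(x in A) (w^\+ x).

Section weighted_measure_instance.
Variables (mu : {measure set T -> \bar R}) (w : {mfun T >-> \bar R}).
Local Notation nu := (weighted_measure mu w).

Let nu0 : nu set0 = 0. Proof. exact: integral_set0. Qed.

Let nu_ge0 A : 0 <= nu A. Proof. exact: integral_ge0. Qed.

Let nu_sigma_additive : semi_sigma_additive nu.
Proof.
apply: semi_sigma_additive_nng_induced => //.
by apply: measurable_funepos; exact: measurable_funP.
Qed.

HB.instance Definition _ :=
  isMeasure.Build d T R nu nu0 nu_ge0 nu_sigma_additive.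

End weighted_measure_instance.

Lemma lee1_lt (p : R) : (1 < p)%R -> 1 <= p%:E.
Proof. by rewrite lee_fin; exact: ltW. Qed.

Definition weighted_Lspace (mu : {measure set T -> \bar R})
    (w : {mfun T >-> \bar R}) (p : R) (p1 : (1 < p)%R) :=
  LspaceType (weighted_measure mu w) (lee1_lt p1).

End Weights.

HB.instance Definition _ d (T : measurableType d) (R : realType) mu w p p1 :=
  Metric.on (@weighted_Lspace d T R mu w p p1).

Section HomogeneousType.
Context d (R : realType) (X : completeBorelMetricType d R).
Local Open Scope ereal_scope.

Definition metric_balls : set (set X) :=
  [set B | exists x (r : R), (0 < r)%R /\ B = ball x r].

Definition doubling (mu : {measure set X -> \bar R}) : Prop :=
  exists C : R, forall (x : X) (r : R), (0 < r)%R ->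
    0 < mu (ball x (2 * r)%R) /\
    mu (ball x (2 * r)%R) <= C%:E * mu (ball x r) < +oo.

Definition metrically_continuous (mu : {measure set X -> \bar R}) : Prop :=
  forall (x : X) (r : R), (0 < r)%R ->
    mu (ball x r `+` ball y r) @[y --> x] --> 0.

End HomogeneousType.
Arguments metric_balls {d R} X.

(* The supremum in [0, +oo], so that the supremum of the empty set is 0. *)
Definition sup_nonneg (R : realType) (A : set (\bar R)) : \bar R :=
  ereal_sup (0%E |` A).

(* Main.v *)
Require Import Defs.
From HB Require Import structures.
From mathcomp Require Import all_boot all_order all_algebra.
From mathcomp Require Import all_classical all_reals all_analysis.
From mathcomp Require Import measurable_realfun ring lra.

(** The weighted measure [nu = w mu] inherits everything from [mu] through one
inequality. Hoelder's inequality and the Muckenhoupt condition bound the [p]-th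
power of the average of [f] over a ball, taken for [mu], by a constant times the
average of [|f| ^ p] taken for [nu] ([ball_average_powR_le]). Tested on
indicators it shows that [nu] is doubling ([weighted_doubling]). With Tonelli's
theorem ([integral_average_le]) it shows that the operators sending [f] to its
averages over balls of radius [r] are bounded on [Lp nu], uniformly in [r]
([ball_average_bounded]). This replaces the maximal function.

A compact set satisfies the three conditions because each of them holds near
every single function, and a property that holds locally on a compact set holds
uniformly on it ([compact_near_coveringP]). For the third condition one needs
that the averages of a fixed [f] converge to [f] in [Lp nu]
([averages_converge_Lp]). By the uniform bound the functions with this property
form a closed subspace; it contains the Lipschitz functions of bounded support,
hence, through monotone limits and a Dynkin class argument, indicators of open
sets, of bounded Borel sets, and finally all of [Lp nu].

Conversely let the three conditions hold. Up to a small error in norm, [f] may be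
replaced by its averages of some fixed radius [r], restricted to a large ball.
Metric continuity of [mu] makes the averages of a bounded family equicontinuous
([ball_average_equicontinuous]). Balls are totally bounded because [mu] is
doubling, so their closures are compact, and finitely many values of the
averages determine them on the ball up to a small error
([ball_averages_colouring]). Thus the family is totally bounded
([totally_bounded_criterion]). As [Lp nu] is complete
([Lspace_small_filters_cvg]), its closure is compact
([totally_bounded_compact]). *)

Set Implicit Arguments.
Unset Strict Implicit.
Unset Printing Implicit Defensive.

Import Order.TTheory GRing.Theory Num.Theory.
Import numFieldNormedType.Exports.

Local Open Scope classical_set_scope.
Local Open Scope ring_scope.

(** * Total boundedness and compactness in metric spaces *)

Section TotallyBounded.
Context {R : realType} {M : metricType R}.
Implicit Types (K : set M) (F : set_system M).

(** The covering pieces are the classes of a finite colouring; unlike balls,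
they need no centres, so that a colouring can be read off from data that lives
outside of [M]. *)
Definition totally_bounded K : Prop :=
  forall e : R, 0 < e -> exists (T : finType) (c : M -> T),
    forall x y, K x -> K y -> c x = c y -> mdist x y < e.

Definition arbitrarily_small F : Prop :=
  forall e : R, 0 < e -> exists2 A, F A &
    forall x y, A x -> A y -> mdist x y < e.

Definition small_filters_cvg : Prop :=
  forall F, ProperFilter F -> arbitrarily_small F -> exists l : M, F --> l.

Lemma cvg_mdistP F (l : M) : Filter F ->
  F --> l <-> forall e : R, 0 < e -> F [set x | mdist l x < e].
Proof.
move=> FF; split=> [Fl e e0|H A /nbhs_ballP[e /= e0 sA]].
  by have := Fl _ (nbhsx_ballx l e e0); rewrite ballEmdist.
by apply: filterS sA _; rewrite ballEmdist; exact: H.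
Qed.

Lemma closure_mdistP K x :
  closure K x <-> forall e : R, 0 < e -> exists2 y, K y & mdist x y < e.
Proof.
split=> [clK e e0|H B /nbhs_ballP[e /= e0 sB]].
  have [y [Ky]] := clK _ (nbhsx_ballx x e e0).
  by rewrite ballEmdist => ?; exists y.
have [y Ky xy] := H _ e0; exists y; split => //; apply: sB.
by rewrite ballEmdist.
Qed.

Lemma totally_bounded_closure K :
  totally_bounded K -> totally_bounded (closure K).
Proof.
move=> tbK e e0; have e3 : 0 < e / 3 by rewrite divr_gt0.
have [T [c cP]] := tbK _ e3.
have /choice[a aP] : forall x, exists y, closure K x -> K y /\ mdist x y < e / 3.
  move=> x; have [/closure_mdistP/(_ _ e3)[y Ky xy]|nK] := pselect (closure K x).
    by exists y.
  by exists x.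
exists T, (c \o a) => x y /aP[Kx xx] /aP[Ky yy] cxy.
have := cP _ _ Kx Ky cxy.
have := metric_triangle x (a x) y; have := metric_triangle (a x) (a y) y.
rewrite (metric_sym (a y) y); lra.
Qed.

(** An ultrafilter contains one class of every finite colouring. *)
Lemma ultra_totally_bounded K F : UltraFilter F -> F K -> totally_bounded K ->
  arbitrarily_small F.
Proof.
move=> FU FK tbK e e0; have [T [c cP]] := tbK _ e0.
have [[t Ft]|nF] := pselect (exists t, F (K `&` [set x | c x = t])).
  by exists (K `&` [set x | c x = t]) => // x y [Kx <-] [Ky cy]; exact: cP.
have : \forall x \near F, forall t, (~` (K `&` [set x | c x = t])) x.
  apply: filter_forall => t.
  by have [Ft|//] := in_ultra_setVsetC (K `&` [set x | c x = t]) FU; case: nF; exists t.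
move=> /(filterI FK)/filter_ex[x [Kx /(_ (c x))]]/=.
by case.
Qed.

Lemma totally_bounded_compact K : small_filters_cvg -> totally_bounded K ->
  compact (closure K).
Proof.
move=> cM /totally_bounded_closure tbK; rewrite compact_ultra => F FU FK.
have [l Fl] := cM F _ (ultra_totally_bounded FU FK tbK).
exists l; split => //; apply: closed_closure => B /Fl FB.
exact: filter_ex (filterI FK FB).
Qed.

(** Completeness need only be tested on fast Cauchy sequences. *)
Lemma fast_cauchy_cvg_small_filters_cvg :
  (forall u : nat -> M, (forall n, mdist (u n) (u n.+1) <= 2 ^- n) ->
     exists l : M, forall e : R, 0 < e -> exists N : nat,
       forall n, (N <= n)%N -> mdist l (u n) < e) ->
  small_filters_cvg.
Proof.
move=> H F FF sF.
have /choice[A AP] : forall n : nat, exists A, F A /\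
    forall x y, A x -> A y -> mdist x y < 2 ^- n.+1.
  move=> n; have [|A FA AP] := sF (2 ^- n.+1); last by exists A.
  by rewrite invr_gt0 exprn_gt0.
have /choice[u uP] : forall n, exists x, A n x.
  by move=> n; exact: filter_ex (AP n).1.
have [n|l lP] := H u.
  have [z [z1 z2]] := filter_ex (filterI (AP n).1 (AP n.+1).1).
  have := (AP n).2 _ _ (uP n) z1; have := (AP n.+1).2 _ _ z2 (uP n.+1).
  have := metric_triangle (u n) z (u n.+1).
  have : 0 <= (2 : R) ^- n by rewrite invr_ge0 exprn_ge0.
  rewrite !exprS !invfM; lra.
exists l; apply/cvg_mdistP => e e0; have e2 : 0 < e / 2 by rewrite divr_gt0.
have [N NP] := lP _ e2.
have [m _ mP] : \forall n \near \oo, (2 : R) ^- n < e / 2.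
  near=> n; rewrite -exprVn -[ltLHS]ger0_norm ?exprn_ge0 ?invr_ge0//.
  near: n; have : `|2^-1 : R| < 1 by rewrite ger0_norm ?invr_ge0// invf_lt1// ltr1n.
  by move=> /cvg_expr/cvgr0Pnorm_lt; exact.
have Nn : (N <= maxn N m)%N by rewrite leq_maxl.
apply: filterS (AP (maxn N m)).1 => x Ax /=.
have := NP _ Nn; have := (AP (maxn N m)).2 _ _ (uP _) Ax.
have := mP (maxn N m) (leq_maxr _ _).
have := metric_triangle l (u (maxn N m)) x.
have : 0 <= (2 : R) ^- (maxn N m) by rewrite invr_ge0 exprn_ge0.
rewrite exprS invfM; lra.
Unshelve. all: by end_near. Qed.

End TotallyBounded.

(** * Balls of a doubling metric measure space *)

Section Doubling.
Context d (R : realType) (X : completeBorelMetricType d R).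
Variable m : {measure set X -> \bar R}.

Lemma in_ball (x : X) r y : ball x r y <-> mdist x y < r.
Proof. by rewrite ballEmdist. Qed.

Lemma open_measurable_borel (U : set X) : open U -> measurable U.
Proof. by rewrite borel_measurableE => oU; exact: sub_gen_smallest. Qed.

Lemma open_mball (x : X) r : open (ball x r).
Proof.
rewrite openE => y /in_ball xy; apply/nbhs_ballP.
exists (r - mdist x y) => /=; first by rewrite subr_gt0.
move=> z /in_ball yz; apply/in_ball.
by rewrite (le_lt_trans (metric_triangle _ y _))// -ltrBrDl.
Qed.

Lemma measurable_mball (x : X) r : measurable (ball x r).
Proof. exact/open_measurable_borel/open_mball. Qed.

Lemma mball_subset (x y : X) r s : mdist x y + s <= r -> ball y s `<=` ball x r.
Proof.
move=> h z /in_ball yz; apply/in_ball.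
by rewrite (le_lt_trans (metric_triangle _ y _))// (lt_le_trans _ h)// ltrD2l.
Qed.

Hypothesis dbl : doubling m.

Lemma doubling_const : exists2 C : R, 0 < C &
  forall x r, 0 < r -> (m (ball x (2 * r)) <= C%:E * m (ball x r))%E.
Proof.
have [C CP] := dbl; exists C => [|x r r0]; last by have [_ /andP[]] := CP x r r0.
have [m0 /andP[mC _]] := CP point _ ltr01.
rewrite ltNge; apply/negP => C0; have := lt_le_trans m0 mC.
by rewrite ltNge => /negP; apply; rewrite mule_le0_ge0// lee_fin.
Qed.

Lemma measure_ball_gt0 x r : 0 < r -> (0 < m (ball x r))%E.
Proof.
move=> r0; have [C CP] := dbl; have [] := CP x (r / 2) ltac:(by rewrite divr_gt0).
by rewrite mulrC divfK.
Qed.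

Lemma measure_ball_fin x r : (m (ball x r) \is a fin_num)%E.
Proof.
have [C CP] := dbl; rewrite ge0_fin_numE//.
have [r0|r0] := leP r 0.
  rewrite (_ : ball x r = set0) ?measure0// -subset0 => y /in_ball.
  by rewrite ltNge (le_trans r0)// mdist_ge0.
have [m0 /andP[mC]] := CP x r r0; have {m0 mC} := lt_le_trans m0 mC.
move=> + lty; rewrite ltey; case: eqP lty => // ->.
have [C1|C1|->] := ltgtP C 0; last by rewrite mul0e ltxx.
- by rewrite lt0_muley ?lte_fin.
- by rewrite gt0_muley ?lte_fin.
Qed.

(** The ball of radius [A] sits inside a dilation of every ball centred in it. *)
Lemma measure_ball_lower_bound x0 A r : 0 < A -> 0 < r ->
  exists2 c : R, 0 < c & forall x, ball x0 A x -> (c%:E <= m (ball x r))%E.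
Proof.
move=> A0 r0; have [C C0 CP] := doubling_const.
have iter_dbl x k : (m (ball x (2 ^+ k * r)) <= (C ^+ k)%:E * m (ball x r))%E.
  elim: k => [|k IH]; first by rewrite expr0 mul1r mul1e.
  rewrite exprS -mulrA (le_trans (CP _ _ _))// ?mulr_gt0 ?exprn_gt0//.
  by rewrite exprS EFinM -muleA lee_wpmul2l// lee_fin ltW.
have [k kP] : exists k, 2 * A <= 2 ^+ k * r.
  exists (Num.truncn (2 * A / r)).+1; rewrite -ler_pdivrMr//.
  rewrite (le_trans (ltW (truncnS_gt _)))// -natrX ler_nat.
  exact/ltnW/ltn_expl.
exists (fine (m (ball x0 A)) / C ^+ k).
  rewrite divr_gt0 ?exprn_gt0// fine_gt0// measure_ball_gt0//=.
  by rewrite -ge0_fin_numE// measure_ball_fin.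
move=> x /in_ball xA; rewrite EFinM fineK ?measure_ball_fin//.
rewrite muleC lee_pdivrMl ?exprn_gt0//; apply: le_trans (iter_dbl x k).
apply: le_measure; rewrite ?inE//; do ?exact: measurable_mball.
by apply: mball_subset; rewrite metric_sym; lra.
Qed.

(** Points of a ball that are pairwise [r] apart carry disjoint balls of
measure bounded below, so that their number is bounded; a family with the
largest number of points is a net. *)
Lemma ball_finite_net x0 A r : 0 < A -> 0 < r ->
  exists s : seq X, forall x, ball x0 A x -> exists2 y, y \in s & mdist y x < r.
Proof.
move=> A0 r0; have r2 : 0 < r / 2 by rewrite divr_gt0.
have [c c0 cP] := measure_ball_lower_bound x0 A0 r2.
pose sep (s : seq X) := (forall x, x \in s -> ball x0 A x) /\
  pairwise (fun x y => r <= mdist x y) s.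
pose M := fine (m (ball x0 (A + r / 2))).
have sep_size s : sep s -> (size s <= Num.truncn (M / c))%N.
  move=> [sA sr].
  have [->//|s0] := eqVneq (size s) 0%N.
  pose B (i : 'I_(size s)) := ball (nth x0 s i) (r / 2).
  have tB : trivIset setT B.
    move=> i j _ _ [z [/in_ball zi /in_ball zj]].
    apply/eqP; apply: contraT => ij.
    have : r <= mdist (nth x0 s i) (nth x0 s j).
      have /pairwiseP := sr => /(_ x0) srP.
      have := ij; rewrite -val_eqE neq_ltn => /orP[] ij'.
        by apply: srP; rewrite ?inE.
      by rewrite metric_sym; apply: srP; rewrite ?inE.
    rewrite leNgt => /negP; case.
    rewrite (le_lt_trans (metric_triangle _ z _))//.
    by rewrite [ltRHS]splitr ltrD// metric_sym.
  have mB i : measurable (B i) by exact: measurable_mball.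
  have Bsub : \big[setU/set0]_(i < size s) B i `<=` ball x0 (A + r / 2).
    apply: (big_ind (fun S => S `<=` ball x0 (A + r / 2))) => //.
      by move=> S1 S2 sub1 sub2; rewrite subUset; split.
    move=> i _; apply: mball_subset; rewrite lerD2r; apply/ltW/in_ball.
    by apply: sA; rewrite mem_nth.
  have : ((c *+ size s)%:E <= M%:E)%E.
    rewrite /M fineK ?measure_ball_fin//.
    apply: (@le_trans _ _ (m (\big[setU/set0]_(i < size s) B i))); last first.
      apply: le_measure => //; rewrite inE; last exact: measurable_mball.
      exact: bigsetU_measurable.
    rewrite measure_bigsetU_ord//.
    apply: (@le_trans _ _ (\sum_(i < size s) c%:E)%E).
      by rewrite sumEFin big_const_ord iter_addr_0.
    by apply: lee_sum => i _; apply/cP/sA/mem_nth.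
  rewrite lee_fin -mulr_natl -ler_pdivlMr// => h.
  by rewrite truncn_ge_nat// (le_trans _ h).
have sep0 : exists n, `[< exists2 s, sep s & size s = n >].
  by exists 0%N; apply/asboolP; exists [::] => //; split.
have bnd n : `[< exists2 s, sep s & size s = n >] -> (n <= Num.truncn (M / c))%N.
  by move=> /asboolP[s /sep_size sM <-].
case: (ex_maxnP sep0 bnd) => n /asboolP[s [sA sr] sn] nmax.
exists s => x xA; apply: contrapT => nx.
have : (n.+1 <= n)%N.
  apply: nmax; apply/asboolP; exists (x :: s); last by rewrite /= sn.
  split=> [y|].
    by rewrite inE => /predU1P[->//|]; exact: sA.
  rewrite /= sr andbT; apply/allP => y ys.
  rewrite leNgt; apply/negP => xy; apply: nx; exists y => //.
  by rewrite metric_sym.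
by rewrite ltnn.
Qed.

Lemma totally_bounded_ball x0 A : 0 < A -> totally_bounded (M := X) (ball x0 A).
Proof.
move=> A0 e e0; have e2 : 0 < e / 2 by rewrite divr_gt0.
have [s sP] := ball_finite_net x0 A0 e2.
exists 'I_(size s).+1, (fun x => inord (find (fun y => mdist y x < e / 2) s)).
move=> x y /sP[x' x's x'x] /sP[y' y's y'y] /(congr1 val)/=.
have hx : has (fun y => mdist y x < e / 2) s by apply/hasP; exists x'.
have hy : has (fun z => mdist z y < e / 2) s by apply/hasP; exists y'.
rewrite !inordK ?ltnS ?find_size// => xy.
have := nth_find x0 hx; have := nth_find x0 hy; rewrite -xy => hy' hx'.
set z := nth x0 s _ in hx' hy'.
rewrite (le_lt_trans (metric_triangle _ z _))//.
by rewrite [ltRHS]splitr ltrD// metric_sym.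
Qed.

Lemma small_filters_cvg_complete : small_filters_cvg (M := X).
Proof.
move=> F FF sF; exists (lim F); apply: cauchy_cvg.
apply: cauchy_exP => e e0; have [A FA AP] := sF e e0.
have [x Ax] := filter_ex FA; exists x.
by apply: filterS FA => y Ay; apply/in_ball; exact: AP.
Qed.

(** Closures of balls are compact by the completeness of [X]. *)
Lemma compact_closure_ball x0 A : 0 < A -> compact (closure (ball x0 A : set X)).
Proof.
move=> A0; apply: totally_bounded_compact; first exact: small_filters_cvg_complete.
exact: totally_bounded_ball.
Qed.

(** By the separability that the finite nets provide, open sets of the product
are countable unions of products of balls. *)
Lemma measurable_mdist_lt r : measurable [set xy : X * X | mdist xy.1 xy.2 < r].
Proof.
pose x0 : X := point.
have /choice[s sP] : forall n : nat, exists s : seq X, forall x,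
    ball x0 n.+1%:R x -> exists2 y, y \in s & mdist y x < n.+1%:R^-1.
  by move=> n; exact: ball_finite_net.
rewrite (_ : mkset _ = \bigcup_n \bigcup_(i < size (s n))
    (ball (nth x0 (s n) i) n.+1%:R^-1 `*`
     ball (nth x0 (s n) i) (r - n.+1%:R^-1))); last first.
  apply/seteqP; split=> [[x y]/= xyr|[x y] [n _] [i _] [/in_ball/= ix /in_ball/= iy]];
    last first.
    have := metric_triangle x (nth x0 (s n) i) y.
    by rewrite (metric_sym x (nth x0 (s n) i)); move: (n.+1%:R^-1) ix iy => e; lra.
  have d0 : 0 < (r - mdist x y) / 2 by rewrite divr_gt0// subr_gt0.
  near \oo => n.
  have xn : ball x0 n.+1%:R x.
    apply/in_ball; near: n.
    near=> n; apply: (@lt_trans _ _ n%:R); last by rewrite ltr_nat.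
    by near: n; exact: nbhs_infty_gtr.
  have [z zs zx] := sP _ _ xn.
  exists n => //; exists (index z (s n)); first by rewrite /= index_mem.
  rewrite nth_index//; split; apply/in_ball => //=.
  have : n.+1%:R^-1 < (r - mdist x y) / 2.
    by near: n; exact: (near_infty_natSinv_lt (PosNum d0)).
  rewrite ltr_pdivlMr// => h1; have := metric_triangle z x y.
  move: (n.+1%:R^-1 : R) zx h1 => e; lra.
apply: bigcup_measurable => n _; apply: bigcup_measurable => i _.
by apply: measurableX; exact: measurable_mball.
Unshelve. all: by end_near. Qed.

End Doubling.

(** * Averages over balls of a doubling measure *)

Section SigmaFiniteCopy.
Context d (T : measurableType d) (R : realType) (m : {measure set T -> \bar R}).
Hypothesis sf : sigma_finite setT m.

(** A copy of [m] on which its sigma-finiteness becomes a structure, as Tonelli's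
theorem wants it. *)
Definition sigma_finite_copy (_ : sigma_finite setT m) : set T -> \bar R := m.

HB.instance Definition _ := Measure.copy (sigma_finite_copy sf) m.
HB.instance Definition _ :=
  Measure_isSigmaFinite.Build d T R (sigma_finite_copy sf) sf.

Lemma sigma_finite_measureE : exists m' : {sigma_finite_measure set T -> \bar R},
  (m' : {measure set T -> \bar R}) = m.
Proof.
by exists (sigma_finite_copy sf); exact: eq_measure.
Qed.

End SigmaFiniteCopy.

Section BallAverages.
Context d (R : realType) (X : completeBorelMetricType d R).
Local Open Scope ereal_scope.

Lemma ball_cover (x : X) : [set: X] = \bigcup_n ball x n%:R.
Proof.
apply/seteqP; split=> // y _; exists (Num.truncn (mdist x y)).+1 => //.
exact/in_ball/truncnS_gt.
Qed.

Lemma doubling_sigma_finite (m : {measure set X -> \bar R}) :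
  doubling m -> sigma_finite setT m.
Proof.
move=> dbl; exists (fun n => ball (point : X) n%:R); first exact: ball_cover.
move=> n; split; first exact: measurable_mball.
by rewrite ltey_eq (measure_ball_fin dbl).
Qed.

Section SigmaFinite.
Variable m : {sigma_finite_measure set X -> \bar R}.
Hypothesis dbl : doubling m.

Lemma sf_measurable_measure_ball (r : R) : measurable_fun setT (fun x : X => m (ball x r)).
Proof.
have := measurable_fun_xsection m (measurable_mdist_lt dbl r).
congr measurable_fun; apply/funext => x /=; congr (m _).
by rewrite ballEmdist; apply/seteqP; split => y; rewrite /xsection/= inE.
Qed.

Lemma sf_measurable_integral_ball (r : R) (g : X -> \bar R) :
  measurable_fun setT g -> (forall x, 0 <= g x) ->
  measurable_fun setT (fun x : X => \int[m]_(y in ball x r) g y).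
Proof.
move=> mg g0; pose E := [set xy : X * X | (mdist xy.1 xy.2 < r)%R].
have mE : measurable E by exact: (measurable_mdist_lt dbl).
pose F (z : X * X) : \bar R := (\1_E z)%:E * g z.2.
have mF : measurable_fun setT F.
  apply: emeasurable_funM; last exact: measurableT_comp mg measurable_snd.
  by apply/measurable_EFinP; exact: measurable_indic.
have F0 z : 0 <= F z by rewrite mule_ge0// lee_fin.
have := @measurable_fun_fubini_tonelli_F _ _ _ _ _ m _ mF F0.
congr measurable_fun; apply/funext => x; rewrite [RHS]integral_mkcond.
apply: eq_integral => y _; rewrite /F patchE indicE/= ballEmdist.
have -> : ((x, y) \in E) = (y \in [set z | (mdist x z < r)%R]).
  by apply/idP/idP; rewrite !inE.
by case: ifP; rewrite ?mul1e ?mul0e.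
Qed.

Lemma sf_integral_average_le : exists2 D : R, (0 < D)%R &
  forall r (g : X -> \bar R), (0 < r)%R -> measurable_fun setT g ->
    (forall x, 0 <= g x) ->
    \int[m]_x ((fine (m (ball x r)))^-1%:E * \int[m]_(y in ball x r) g y) <=
    D%:E * \int[m]_y g y.
Proof.
have [D D0 DP] := doubling_const dbl; exists D => // r g r0 mg g0.
pose k x : R := (fine (m (ball x r)))^-1%R.
have k0 x : (0 <= k x)%R by rewrite invr_ge0 fine_ge0.
have mk : measurable_fun setT k.
  have : measurable_fun setT (fun x => fine (m (ball x r))).
    by apply: measurableT_comp => //; exact: sf_measurable_measure_ball.
  move=> mf; rewrite (_ : k = fun x => fine (m (ball x r)) `^ (-1))%R.
    exact: (measurableT_comp (measurable_powR (-1)%R) mf).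
  by apply/funext => x; rewrite powR_inv1 ?fine_ge0.
pose E := [set xy : X * X | (mdist xy.1 xy.2 < r)%R].
have mE : measurable E by exact: (measurable_mdist_lt dbl).
pose F (z : X * X) : \bar R := (k z.1 * \1_E z)%:E * g z.2.
have mF : measurable_fun setT F.
  apply: emeasurable_funM; last exact: measurableT_comp mg measurable_snd.
  apply/measurable_EFinP/measurable_funM; last exact: measurable_indic.
  exact: measurableT_comp mk measurable_fst.
have F0 z : 0 <= F z by rewrite mule_ge0// lee_fin mulr_ge0.
have EE x y : \1_E (x, y) = \1_(ball x r) y :> R.
  by rewrite !indicE; congr (nat_of_bool _)%:R; apply/idP/idP; rewrite !inE ballEmdist.
have EE' x y : \1_E (x, y) = \1_(ball y r) x :> R.
  by rewrite EE !indicE; congr (nat_of_bool _)%:R; apply/idP/idP; rewrite !inE => /ball_sym.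
rewrite [leLHS](_ : _ = \int[m]_x \int[m]_y F (x, y)); last first.
  apply: eq_integral => x _.
  have mgx : measurable_fun setT (g \_ (ball x r)).
    exact/(measurable_restrictT g (measurable_mball x r))/measurable_funTS.
  have gx0 y : setT y -> 0 <= (g \_ (ball x r)) y by rewrite patchE; case: ifP.
  have kx0 : 0 <= ((fine (m (ball x r)))^-1)%:E by rewrite lee_fin; exact: k0.
  rewrite integral_mkcond -(ge0_integralZl _ measurableT mgx gx0 kx0)//.
  apply: eq_integral => y _; rewrite /F/= EE EFinM -muleA patchE indicE.
  by case: ifP; rewrite ?mul1e ?mul0e.
have := @fubini_tonelli _ _ _ _ _ m m _ mF F0; rewrite /fubini_F /fubini_G => ->.
rewrite -ge0_integralZl//; last by rewrite lee_fin ltW.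
apply: ge0_le_integral => //.
- by move=> y _; apply: integral_ge0.
- exact: (@measurable_fun_fubini_tonelli_G _ _ _ _ _ m _ mF F0).
- exact: measurable_funeM.
move=> y _.
have mb : measurable (ball y r) by exact: measurable_mball.
rewrite [leLHS](_ : _ = g y * \int[m]_(x in ball y r) (k x)%:E); last first.
  have mky : measurable_fun setT ((EFin \o k) \_ (ball y r)).
    by apply/(measurable_restrictT _ mb)/measurable_EFinP/measurable_funTS.
  have ky0 x : setT x -> 0 <= ((EFin \o k) \_ (ball y r)) x.
    by rewrite patchE; case: ifP; rewrite ?lee_fin.
  rewrite [in RHS]integral_mkcond -(ge0_integralZl _ measurableT mky ky0 (g0 y))//.
  apply: eq_integral => x _; rewrite /F/= EE' muleC patchE indicE.
  by case: ifP; rewrite ?mulr1 ?mulr0.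
rewrite muleC lee_wpmul2r//.
have by0 : (0 < fine (m (ball y r)))%R.
  by rewrite fine_gt0// (measure_ball_gt0 dbl)// ltey_eq (measure_ball_fin dbl).
apply: (@le_trans _ _ (\int[m]_(x in ball y r) (D / fine (m (ball y r)))%:E)).
  apply: ge0_le_integral => //.
  - by move=> x _; rewrite lee_fin.
  - by apply/measurable_EFinP; exact: measurable_funTS.
  move=> x /in_ball xy; rewrite lee_fin /k.
  have bx0 : (0 < fine (m (ball x r)))%R.
    by rewrite fine_gt0// (measure_ball_gt0 dbl)// ltey_eq (measure_ball_fin dbl).
  rewrite ler_pdivlMr// ler_pdivrMl// -lee_fin mulrC EFinM.
  rewrite !fineK ?(measure_ball_fin dbl)//.
  apply: le_trans (DP _ _ r0); apply: le_measure; rewrite ?inE//.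
    exact: measurable_mball.
  by apply: mball_subset; rewrite metric_sym mulrDl mul1r lerD2r ltW.
rewrite integral_cst// -[X in _ * X](fineK (measure_ball_fin dbl y r)) -EFinM.
by rewrite lee_fin divfK// gt_eqF.
Qed.

End SigmaFinite.

Lemma measurable_measure_ball (m : {measure set X -> \bar R}) (r : R) :
  doubling m -> measurable_fun setT (fun x : X => m (ball x r)).
Proof.
move=> dbl; have [m' m'E] := sigma_finite_measureE (doubling_sigma_finite dbl).
by move: dbl; rewrite -m'E => dbl'; exact: (sf_measurable_measure_ball dbl' r).
Qed.

Lemma measurable_integral_ball (m : {measure set X -> \bar R}) (r : R)
    (g : X -> \bar R) : doubling m ->
  measurable_fun setT g -> (forall x, 0 <= g x) ->
  measurable_fun setT (fun x : X => \int[m]_(y in ball x r) g y).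
Proof.
move=> dbl; have [m' m'E] := sigma_finite_measureE (doubling_sigma_finite dbl).
by move: dbl; rewrite -m'E => dbl'; exact: (sf_measurable_integral_ball dbl').
Qed.

(** Exchanging the integrals, the weight [1 / m (ball x r)] integrates over
[ball y r] to at most the doubling constant, because [ball y r] lies in
[ball x (2 * r)]. *)
Lemma integral_average_le (m : {measure set X -> \bar R}) : doubling m ->
  exists2 D : R, (0 < D)%R &
  forall r (g : X -> \bar R), (0 < r)%R -> measurable_fun setT g ->
    (forall x, 0 <= g x) ->
    \int[m]_x ((fine (m (ball x r)))^-1%:E * \int[m]_(y in ball x r) g y) <=
    D%:E * \int[m]_y g y.
Proof.
move=> dbl; have [m' m'E] := sigma_finite_measureE (doubling_sigma_finite dbl).
by move: dbl; rewrite -m'E => dbl'; exact: (sf_integral_average_le dbl').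
Qed.

End BallAverages.

(** * Integrals against a density and Lp norms *)

Section Density.
Context d (T : measurableType d) (R : realType).
Variables (mu nu : {measure set T -> \bar R}) (v : T -> R).
Hypotheses (mv : measurable_fun setT v) (v0 : forall x, 0 <= v x).
Hypothesis nuE : forall A, measurable A -> nu A = (\int[mu]_(x in A) (v x)%:E)%E.
Local Open Scope ereal_scope.
Import HBNNSimple.

Lemma integral_density (D : set T) (g : T -> \bar R) : measurable D ->
  measurable_fun D g -> (forall x, D x -> 0 <= g x) ->
  \int[nu]_(x in D) g x = \int[mu]_(x in D) (g x * (v x)%:E).
Proof.
move=> mD mg g0; pose h := nnsfun_approx mD mg.
have mvE : measurable_fun setT (EFin \o v) by exact/measurable_EFinP.
have hv n : \int[nu]_(x in D) (h n x)%:E =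
    \int[mu]_(x in D) ((h n x)%:E * (v x)%:E).
  have mpre r : measurable (h n @^-1` [set r]) by [].
  under eq_integral => x _ do rewrite fimfunE -fsumEFin//.
  rewrite ge0_integral_fsum//; last 2 first.
  - by move=> r; apply/measurable_EFinP/measurable_funTS; exact: measurable_funM.
  - by move=> r x _; exact: nnfun_muleindic_ge0.
  under [RHS]eq_integral => x _.
    rewrite fimfunE -fsumEFin// ge0_mule_fsuml; last first.
      by move=> r; exact: nnfun_muleindic_ge0.
    over.
  rewrite ge0_integral_fsum//; last 2 first.
  - move=> r; apply: measurable_funTS; apply: emeasurable_funM => //.
    by apply/measurable_EFinP; exact: measurable_funM.
  - by move=> r x _; rewrite mule_ge0 ?lee_fin ?v0//; exact: nnfun_muleindic_ge0.
  apply: eq_fsbigr => r rh.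
  have [y _ rE] := set_mem rh.
  have r0 : 0 <= r%:E by rewrite -rE lee_fin.
  under eq_integral => x _ do rewrite EFinM.
  rewrite ge0_integralZl//; last by apply/measurable_EFinP/measurable_funTS.
  under [RHS]eq_integral => x _ do rewrite EFinM -muleA.
  rewrite ge0_integralZl//; last 2 first.
  - apply: measurable_funTS; apply: emeasurable_funM => //.
    exact/measurable_EFinP.
  - by move=> x _; rewrite mule_ge0// lee_fin.
  congr (_ * _); rewrite integral_indic// nuE; last exact: measurableI.
  rewrite setIC integral_mkcondr; apply: eq_integral => x _.
  by rewrite patchE indicE; case: ifP; rewrite ?mul1e ?mul0e.
have -> : \int[nu]_(x in D) g x = limn (fun n => \int[nu]_(x in D) (h n x)%:E).
  rewrite -monotone_convergence//.
  - apply: eq_integral => x /set_mem Dx; apply/esym/cvg_lim => //.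
    exact: cvg_nnsfun_approx.
  - by move=> n; apply/measurable_EFinP/measurable_funTS.
  - by move=> n x _; rewrite lee_fin.
  - by move=> x _ a b ab; rewrite lee_fin; exact/lefP/nd_nnsfun_approx.
under eq_fun do rewrite hv.
rewrite -monotone_convergence//.
- apply: eq_integral => x /set_mem Dx; apply/cvg_lim => //.
  by apply: cvgeZr => //; exact: cvg_nnsfun_approx.
- move=> n; apply: measurable_funTS; apply: emeasurable_funM => //.
  exact/measurable_EFinP.
- by move=> n x _; rewrite mule_ge0// lee_fin.
- move=> x _ a b ab; rewrite lee_wpmul2r ?lee_fin//.
  exact/lefP/nd_nnsfun_approx.
Qed.

End Density.

Section Lnorm.
Context d (T : measurableType d) (R : realType).
Variables (m : {measure set T -> \bar R}) (p : R).
Hypothesis p1 : 1 < p.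
Implicit Types f g h : T -> R.
Local Open Scope ereal_scope.

Let p0 : (0 < p)%R. Proof. exact: lt_trans p1. Qed.

Local Notation N f := ('N[m]_p%:E[EFin \o f]).

Lemma measurable_powR_norm (D : set T) f : measurable_fun D f ->
  measurable_fun D (fun x => (`|f x| `^ p)%:E).
Proof.
move=> mf; apply/measurable_EFinP.
apply: (measurableT_comp (measurable_powR p)).
exact: measurableT_comp.
Qed.

Lemma Lnorm_powR f : N f `^ p = \int[m]_x (`|f x| `^ p)%:E.
Proof. by rewrite poweR_Lnorm// gt_eqF. Qed.

Lemma Lnorm_le f (c : R) : (0 <= c)%R ->
  (N f <= c%:E) = (\int[m]_x (`|f x| `^ p)%:E <= (c `^ p)%:E).
Proof.
move=> c0; rewrite -Lnorm_powR -poweR_EFin.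
have inI (x : \bar R) : 0 <= x -> x \in `[0, +oo] by move=> x0; rewrite in_itv/= x0 leey.
apply/idP/idP => h.
  apply: (gt0_ler_poweR (ltW p0)) => //; apply: inI; rewrite ?lee_fin//.
  exact: Lnorm_ge0.
have ip0 : (0 <= p^-1)%R by rewrite invr_ge0 ltW.
have := gt0_ler_poweR ip0 (inI _ (poweR_ge0 _ _)) (inI _ (poweR_ge0 _ _)) h.
by rewrite -!poweRrM divff ?gt_eqF// !poweRe1 ?Lnorm_ge0 ?lee_fin.
Qed.

Lemma Lnorm_lty f : (N f < +oo) = (\int[m]_x (`|f x| `^ p)%:E < +oo).
Proof.
rewrite -Lnorm_powR; apply/idP/idP => [/poweR_lty//|].
by apply: lty_poweRy; rewrite gt_eqF.
Qed.

Lemma ae_eq_Lnorm f g : measurable_fun setT f -> measurable_fun setT g ->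
  f = g %[ae m] -> N f = N g.
Proof.
move=> mf mg fg; rewrite unlock; congr (_ `^ _).
apply: ae_eq_integral => //; [exact: measurable_powR_norm..|].
by apply: filterS fg => x /(_ I)/= fgx _; rewrite /= fgx.
Qed.

Lemma Lnorm_mono f g : measurable_fun setT f -> measurable_fun setT g ->
  (forall x, `|f x| <= `|g x|)%R -> N f <= N g.
Proof.
move=> mf mg fg; rewrite unlock; apply: gt0_ler_poweR.
- by rewrite invr_ge0 ltW.
- by rewrite in_itv/= leey andbT integral_ge0// => x _; rewrite lee_fin powR_ge0.
- by rewrite in_itv/= leey andbT integral_ge0// => x _; rewrite lee_fin powR_ge0.
apply: ge0_le_integral => //.
- by move=> x _; rewrite lee_fin powR_ge0.
- exact: measurable_powR_norm.
- exact: measurable_powR_norm.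
- by move=> x _; rewrite lee_fin ge0_ler_powR// ?nnegrE// ltW.
Qed.

Lemma Lnorm_sub_le f g : measurable_fun setT f -> measurable_fun setT g ->
  N (fun x => f x - g x)%R <= N f + N g.
Proof.
move=> mf mg; have mNg : measurable_fun setT (fun x => - g x)%R by exact: measurableT_comp.
apply: le_trans (eminkowski m mf mNg (lee1_lt p1)) _.
by rewrite -[in leRHS](oppe_Lnorm m (EFin \o g)).
Qed.

Lemma Lnorm_sub_triangle f g h : measurable_fun setT f -> measurable_fun setT g ->
  measurable_fun setT h ->
  N (fun x => f x - h x)%R <= N (fun x => f x - g x)%R + N (fun x => g x - h x)%R.
Proof.
move=> mf mg mh.
have := eminkowski m (measurable_funB mf mg) (measurable_funB mg mh) (lee1_lt p1).
apply: le_trans; rewrite le_eqVlt; apply/orP; left; apply/eqP.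
by apply: eq_Lnorm => x /=; rewrite subrKA.
Qed.

Lemma Lnorm_subC f g : N (fun x => f x - g x)%R = N (fun x => g x - f x)%R.
Proof.
rewrite -[LHS]oppe_Lnorm; apply: eq_Lnorm => x /=.
exact: (congr1 EFin (opprB _ _)).
Qed.

End Lnorm.

(** * Completeness of Lp *)

Section RieszFischer.
Context d (T : measurableType d) (R : realType).
Variables (m : {measure set T -> \bar R}) (p : R).
Hypothesis p1 : 1 < p.
Local Open Scope ereal_scope.

Let p0 : (0 < p)%R. Proof. exact: lt_trans p1. Qed.

Local Notation N f := ('N[m]_p%:E[EFin \o f]).

Variable u : nat -> T -> R.
Hypothesis mu_ : forall n, measurable_fun setT (u n).
Hypothesis fast : forall n, N (fun x => u n x - u n.+1 x)%R <= (2 ^- n)%:E.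

Let G n k x : R := (\sum_(i < k) `|u (n + i)%N x - u (n + i).+1 x|)%R.

Let mG n k : measurable_fun setT (G n k).
Proof.
by apply: measurable_sum => i; apply: measurableT_comp => //; exact: measurable_funB.
Qed.

Let G0 n k x : (0 <= G n k x)%R. Proof. exact: sumr_ge0. Qed.

Let two_exp n : (2 * 2 ^- n = 2 ^- n + 2 * 2 ^- n.+1 :> R)%R.
Proof. by rewrite exprS invfM mulVKf// mulr_natl mulr2n. Qed.

Let two_exp_gt0 n : (0 < 2 ^- n :> R)%R.
Proof. by rewrite invr_gt0 exprn_gt0. Qed.

Let NG n k : N (G n k) <= (2 * 2 ^- n - 2 * 2 ^- (n + k))%:E.
Proof.
elim: k => [|k IH].
  rewrite addn0 subrr (_ : EFin \o _ = cst 0) ?Lnorm0//.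
    by rewrite eqe gt_eqF.
  by apply/funext => x; rewrite /= /G big_ord0.
pose D x := `|u (n + k)%N x - u (n + k).+1 x|%R.
have mD : measurable_fun setT D.
  by apply: measurableT_comp => //; exact: measurable_funB.
rewrite (_ : EFin \o _ = EFin \o (G n k \+ D)%R); last first.
  by apply/funext => x; rewrite /= /G big_ord_recr.
apply: le_trans (eminkowski m (mG n k) mD (lee1_lt p1)) _ => //.
have ND : N D <= (2 ^- (n + k))%:E.
  apply: le_trans (fast (n + k)); rewrite le_eqVlt; apply/orP; left; apply/eqP.
  by rewrite -[RHS]Lnorm_abse.
apply: le_trans (leeD IH ND) _.
by rewrite addnS -EFinD lee_fin (two_exp (n + k)); lra.
Qed.

Let h n k x := (`|G n k x| `^ p)%:E.

Let h_nd n x : nondecreasing_seq (fun k => h n k x).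
Proof.
move=> a b ab; rewrite lee_fin ge0_ler_powR ?nnegrE ?(ltW p0)//.
rewrite !ger0_norm// /G.
rewrite (big_ord_widen _ (fun i => `|u (n + i)%N x - u (n + i).+1 x|)%R ab).
rewrite [leRHS](bigID (fun i : 'I_b => (i < a)%N))/= lerDl.
exact: sumr_ge0.
Qed.

Let H n x := ereal_sup (range (fun k => h n k x)).

Let h_cvg n x : h n k x @[k --> \oo] --> H n x.
Proof. exact/ereal_nondecreasing_cvgn/h_nd. Qed.

Let mh n k : measurable_fun setT (h n k).
Proof. exact: measurable_powR_norm. Qed.

Let mH n : measurable_fun setT (H n).
Proof. by apply: (emeasurable_fun_cvg (h n)) => // x _; exact: h_cvg. Qed.

Let hH n k x : h n k x <= H n x.
Proof. by apply: ereal_sup_ubound; exists k. Qed.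

Let H0 n x : 0 <= H n x.
Proof. by apply: le_trans (hH n 0%N x); rewrite lee_fin powR_ge0. Qed.

Let intH n : \int[m]_x H n x <= ((2 * 2 ^- n) `^ p)%:E.
Proof.
have -> : \int[m]_x H n x = \int[m]_x limn (fun k => h n k x).
  by apply: eq_integral => x _; apply/esym/cvg_lim => //; exact: h_cvg.
have h0 k x : setT x -> 0 <= h n k x by rewrite lee_fin powR_ge0.
rewrite monotone_convergence//.
apply: lime_le.
  apply: ereal_nondecreasing_is_cvgn => a b ab; apply: ge0_le_integral => //.
  - by move=> x; exact: h0.
  - by move=> x _; exact: h_nd.
apply: nearW => k; rewrite -Lnorm_le//.
apply: le_trans (NG n k) _; rewrite lee_fin.
by have := two_exp_gt0 (n + k); lra.
Qed.

Let G_le n k x : H n x \is a fin_num -> (G n k x <= fine (H n x) `^ p^-1)%R.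
Proof.
move=> Hfin; have : (G n k x `^ p <= fine (H n x))%R.
  by rewrite -lee_fin fineK// -[X in (X `^ p)%R]ger0_norm//; exact: hH.
have ip0 : (0 <= p^-1)%R by rewrite invr_ge0 ltW.
move=> /(ge0_ler_powR ip0); rewrite !nnegrE powR_ge0 fine_ge0// => /(_ isT isT).
by rewrite -powRrM divff ?gt_eqF// powRr1.
Qed.

Let u_G n k x : (`|u (n + k)%N x - u n x| <= G n k x)%R.
Proof.
elim: k => [|k IH]; first by rewrite addn0 subrr normr0 /G big_ord0.
rewrite /G big_ord_recr /= -/(G n k x) addnS.
apply: le_trans (ler_distD (u (n + k)%N x) _ _) _.
by rewrite addrC lerD// distrC.
Qed.

Let u_cvg : {ae m, forall x, cvgn (u ^~ x)}.
Proof.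
have : m.-integrable setT (H 0%N).
  apply/integrableP; split => //.
  under eq_integral => x _ do rewrite gee0_abs//.
  exact: le_lt_trans (intH 0) (ltry _).
move=> /(integrable_ae measurableT); apply: filterS => x /(_ I) Hfin.
have -> : u ^~ x = (fun n => u 0%N x + series (telescope (u ^~ x)) n)%R.
  by apply/funext => n; exact: (eq_sum_telescope (u ^~ x)).
apply: is_cvgD; first exact: is_cvg_cst.
apply: normed_cvg; apply: nondecreasing_is_cvgn.
  by apply: nondecreasing_series => n _ _; exact: normr_ge0.
exists (fine (H 0%N x) `^ p^-1)%R => _ [n _ <-]; apply: le_trans (G_le n Hfin).
change (\sum_(0 <= k < n) `|u k.+1 x - u k x| <= G 0 n x)%R.
by rewrite big_mkord /G; apply: ler_sum => k _; rewrite distrC.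
Qed.

(** The partial sums of the differences bound the distance to the limit, and
their norms are bounded by Minkowski's inequality; monotone convergence applied
to these sums gives both the almost everywhere convergence and the rate. *)
Lemma Lp_fast_cauchy_cvg : exists l : T -> R, measurable_fun setT l /\
  forall n, N (fun x => l x - u n x)%R <= (2 * 2 ^- n)%:E.
Proof.
pose L x := limn_esup (fun n => (u n x)%:E).
have mL : measurable_fun setT L.
  by apply: measurable_fun_limn_esup => n; exact/measurable_EFinP.
exists (fine \o L); have ml : measurable_fun setT (fine \o L) by exact: measurableT_comp.
split=> // n.
have n0 : (0 <= 2 * 2 ^- n :> R)%R by rewrite mulr_ge0// ltW.
rewrite Lnorm_le//; apply: le_trans (intH n).
apply: ae_ge0_le_integral => //.
- by apply: measurable_powR_norm => //; exact: measurable_funB.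
apply: filterS u_cvg => x /cvg_ex[a ua] _.
have -> : (fine \o L) x = a.
  have uaE : (u n x)%:E @[n --> \oo] --> a%:E by apply: cvg_EFin; [exact: nearW|exact: ua].
  by rewrite /= /L (cvg_limn_einf_sup uaE).2.
have [Hfin|] := boolP (H n x \is a fin_num); last first.
  by rewrite ge0_fin_numE// -leNgt leye_eq => /eqP ->; rewrite leey.
rewrite -(fineK Hfin) lee_fin.
have -> : fine (H n x) = ((fine (H n x) `^ p^-1) `^ p)%R.
  by rewrite -powRrM mulVf ?gt_eqF// powRr1// fine_ge0.
apply: ge0_ler_powR; rewrite ?nnegrE ?powR_ge0 ?(ltW p0)//.
have uan : (`|u (n + k)%N x - u n x|)%R @[k --> \oo] --> `|a - u n x|%R.
  apply: cvg_norm; apply: cvgB; last exact: cvg_cst.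
  have := ua; rewrite -(cvg_shiftn n).
  by under eq_fun do rewrite addnC.
have <- := cvg_lim _ uan => //; apply: limr_le; first by apply/cvg_ex; eexists; exact: uan.
by apply: nearW => k; apply: le_trans (u_G n k x) (G_le k Hfin).
Qed.

End RieszFischer.

Section LspaceComplete.
Context d (T : measurableType d) (R : realType).
Variables (m : {measure set T -> \bar R}) (p : R) (p1 : (1 < p)%R).
Local Open Scope ereal_scope.
Local Notation Lp := (LspaceType m (lee1_lt p1)).
Local Notation N f := ('N[m]_p%:E[EFin \o f]).

Lemma measurable_Lspace (f : Lp) : measurable_fun [set: T] (f : T -> R).
Proof. exact: (measurable_funP (repr (LebesgueSpace.sort f))). Qed.

Lemma Lspace_lty (f : Lp) : N f < +oo.
Proof. exact: Lebesgue_finite. Qed.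

Lemma Lspace_mdistE (f g : Lp) : (mdist f g)%:E = N (fun x => f x - g x)%R.
Proof.
rewrite {1}/mdist/= /Lspace_dist fineK// ge0_fin_numE ?Lnorm_ge0//.
have mf := measurable_Lspace f; have mg := measurable_Lspace g.
apply: le_lt_trans (Lnorm_sub_le m p1 mf mg) _.
by rewrite lte_add_pinfty ?Lspace_lty.
Qed.

Lemma Lspace_of_fun (f : T -> R) : measurable_fun setT f -> N f < +oo ->
  exists F : Lp, (F : T -> R) = f %[ae m].
Proof.
move=> mf Nf.
pose f' : {mfun T >-> measurableTypeR R} :=
  @mfun_Sub _ _ T (measurableTypeR R) f (mem_set mf).
pose q : {mfun_ m, T >-> measurableTypeR R} := (\pi f')%qT.
have qf : (q : T -> R) = f %[ae m].
  have /asboolP : ae_eq_op m (repr q) f' by apply/eqquotP; exact: reprK.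
  by [].
have Nq : finite_norm m p%:E q.
  by rewrite /finite_norm (ae_eq_Lnorm p (measurable_funP (repr q)) mf qf).
pose F : Lp := HB.pack q (isFinLebesgue.Build _ _ _ _ _ (lee1_lt p1) q Nq).
by exists F.
Qed.

Lemma Lspace_small_filters_cvg : small_filters_cvg (M := Lp).
Proof.
apply: fast_cauchy_cvg_small_filters_cvg => u fast.
have mu_ n := measurable_Lspace (u n).
have [||l [ml lP]] := @Lp_fast_cauchy_cvg _ _ _ m p p1 (fun n => u n : T -> R).
- exact: mu_.
- by move=> n; rewrite -Lspace_mdistE lee_fin.
have [F Fl] : exists F : Lp, (F : T -> R) = l %[ae m].
  apply: Lspace_of_fun => //.
  have := eminkowski m (measurable_funB ml (mu_ 0%N)) (mu_ 0%N) (lee1_lt p1).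
  rewrite (_ : EFin \o (_ \+ _)%R = EFin \o l); last first.
    by apply/funext => x; rewrite /= subrK.
  move=> /le_lt_trans; apply; rewrite lte_add_pinfty ?Lspace_lty//.
  exact: le_lt_trans (lP _) (ltry _).
exists F => e e0.
have FE n : (mdist F (u n) <= 2 * 2 ^- n)%R.
  rewrite -lee_fin Lspace_mdistE (_ : 'N[m]_p%:E[_] = N (fun x => l x - u n x)%R)//.
  apply: ae_eq_Lnorm.
  - by apply: measurable_funB => //; exact: measurable_Lspace.
  - exact: measurable_funB.
  - by apply: filterS Fl => x /(_ I)/= Fx _; rewrite /= Fx.
have [N _ NP] : \forall n \near \oo, (2 * (2 : R) ^- n < e)%R.
  near=> n; rewrite mulrC -ltr_pdivlMr// -exprVn.
  rewrite -[ltLHS]ger0_norm ?exprn_ge0 ?invr_ge0//.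
  near: n; have : (`|2^-1 : R| < 1)%R by rewrite ger0_norm ?invr_ge0// invf_lt1// ltr1n.
  by move=> /cvg_expr/cvgr0Pnorm_lt; apply; rewrite divr_gt0.
by exists N => n /NP; apply: le_lt_trans; exact: FE.
Unshelve. all: by end_near. Qed.

End LspaceComplete.

(** * The Muckenhoupt condition *)

Section WeightedHoelder.
Context d (T : measurableType d) (R : realType).
Variables (mu nu : {measure set T -> \bar R}) (v : T -> R) (p : R).
Hypotheses (mv : measurable_fun setT v) (v0 : forall x, 0 < v x) (p1 : 1 < p).
Hypothesis nuE : forall A, measurable A -> nu A = (\int[mu]_(x in A) (v x)%:E)%E.
Local Open Scope ereal_scope.

Let p0 : (0 < p)%R. Proof. exact: lt_trans p1. Qed.

Let v0' x : (0 <= v x)%R. Proof. exact: ltW. Qed.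

(** The weight [v `^ (1 - p')], as [1 - p' = - (p - 1)^-1]. *)
Definition dual_weight (x : T) : R := (v x `^ (- (p - 1)^-1))%R.

Lemma measurable_dual_weight : measurable_fun setT dual_weight.
Proof. exact: (measurableT_comp (measurable_powR _) mv). Qed.

Lemma dual_weight_gt0 x : (0 < dual_weight x)%R.
Proof. exact: powR_gt0. Qed.

(** Hoelder's inequality for the product of [`|f| * v `^ p^-1] and
[v `^ (- p^-1)]; the power of the second factor that it integrates is
[dual_weight]. *)
Lemma weighted_hoelder (E : set T) (f : T -> R) : measurable E ->
  measurable_fun setT f ->
  (\int[mu]_(x in E) `|f x|%:E) `^ p <=
  (\int[nu]_(x in E) (`|f x| `^ p)%:E) *
  (\int[mu]_(x in E) (dual_weight x)%:E) `^ (p - 1).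
Proof.
move=> mE mf.
have pp : (0 < p - 1)%R by rewrite subr_gt0.
pose q := (p / (p - 1))%R.
have q0 : (0 < q)%R by rewrite divr_gt0.
have pq : (p^-1 + q^-1 = 1)%R by rewrite /q; field; rewrite !gt_eqF.
pose F x := (`|f x| * v x `^ p^-1 * \1_E x)%R.
pose G x := (v x `^ (- p^-1) * \1_E x)%R.
have mF : measurable_fun setT F.
  apply: measurable_funM => //; apply: measurable_funM.
    exact: measurableT_comp.
  exact: (measurableT_comp (measurable_powR _) mv).
have mG : measurable_fun setT G.
  by apply: measurable_funM => //; exact: (measurableT_comp (measurable_powR _) mv).
have F0 x : (0 <= F x)%R by rewrite !mulr_ge0// powR_ge0.
have G0 x : (0 <= G x)%R by rewrite !mulr_ge0// powR_ge0.
have ind (a : R) x : ((\1_E x : R) `^ a = if x \in E then 1 else 0 `^ a)%R.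
  by rewrite indicE; case: ifP; rewrite ?powR1.
have L1 : 'N[mu]_1[EFin \o (F \* G)%R] = \int[mu]_(x in E) `|f x|%:E.
  rewrite Lnorm1 [RHS]integral_mkcond; apply: eq_integral => x _.
  rewrite /= patchE ger0_norm ?mulr_ge0 ?powR_ge0// /F /G.
  rewrite indicE.
  case: ifP => _; last by rewrite !mulr0.
  rewrite !mulr1 -mulrA -powRD ?subrr ?powRr0 ?mulr1//.
  by rewrite (gt_eqF (v0 x)) implybT.
have L2 : 'N[mu]_p%:E[EFin \o F] `^ p = \int[nu]_(x in E) (`|f x| `^ p)%:E.
  have mfp : measurable_fun E (fun x => (`|f x| `^ p)%:E).
    by apply: measurable_funTS; exact: measurable_powR_norm.
  have fp0 : forall y, E y -> 0 <= (`|f y| `^ p)%:E.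
    by move=> y _; rewrite lee_fin powR_ge0.
  rewrite Lnorm_powR// (integral_density mv v0' nuE mE mfp fp0).
  rewrite [RHS]integral_mkcond; apply: eq_integral => x _.
  rewrite patchE ger0_norm// /F powRM ?mulr_ge0 ?powR_ge0// powRM ?powR_ge0//.
  rewrite -powRrM mulVf ?gt_eqF// powRr1 ?ltW// ind.
  by case: ifP => _; rewrite ?mulr1// powR0 ?gt_eqF// mulr0.
have L3 : 'N[mu]_q%:E[EFin \o G] `^ q = \int[mu]_(x in E) (dual_weight x)%:E.
  rewrite poweR_Lnorm ?gt_eqF// [RHS]integral_mkcond; apply: eq_integral => x _.
  rewrite patchE /= ger0_norm// /G powRM ?powR_ge0// ind.
  case: ifP => _; last by rewrite powR0 ?gt_eqF// mulr0.
  rewrite mulr1 -powRrM /dual_weight; congr (_ `^ _)%:E%R.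
  by rewrite /q; field; rewrite !gt_eqF.
have := hoelder mu mF mG p0 q0 pq; rewrite L1 => hol.
rewrite -L2 -L3 -poweRrM.
have -> : (q * (p - 1) = p)%R by rewrite /q divfK// gt_eqF.
rewrite -poweRM ?Lnorm_ge0//.
have inI (x : \bar R) : 0 <= x -> x \in `[0, +oo] by move=> x0; rewrite in_itv/= x0 leey.
apply: (gt0_ler_poweR (ltW p0)) => //; apply: inI.
  exact: integral_ge0.
by rewrite mule_ge0 ?Lnorm_ge0.
Qed.

End WeightedHoelder.

Section RealWeight.
Context d (T : measurableType d) (R : realType).
Variables (mu : {measure set T -> \bar R}) (w : {mfun T >-> \bar R}).
Hypothesis w_weight : is_weight mu w.
Local Open Scope ereal_scope.

(** A weight is positive and finite almost everywhere only. A real version of it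
that is positive everywhere has real powers that are positive everywhere. *)
Lemma weight_real_version : exists v : T -> R, [/\ measurable_fun setT v,
  forall x, (0 < v x)%R & {ae mu, forall x, w x = (v x)%:E}].
Proof.
have mt : measurable_fun setT (fun x => fine (w x)).
  by apply: measurableT_comp => //; exact: measurable_funP.
exists (fun x => if (0 < fine (w x))%R then fine (w x) else 1%R); split.
- apply: measurable_fun_ifT => //.
  by apply: measurable_fun_ltr.
- by move=> x; case: ifP.
- apply: filterS w_weight => x /andP[w0 wy].
  have wfin : w x \is a fin_num by rewrite ge0_fin_numE// ltW.
  by rewrite fine_gt0 ?w0//= fineK.
Qed.

Variable v : T -> R.
Hypotheses (mv : measurable_fun setT v) (v0 : forall x, (0 < v x)%R).
Hypothesis wv : {ae mu, forall x, w x = (v x)%:E}.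

Lemma weighted_measureE A : measurable A ->
  weighted_measure mu w A = \int[mu]_(x in A) (v x)%:E.
Proof.
move=> mA; apply: ae_eq_integral => //.
- by apply/measurable_funTS/measurable_funepos; exact: measurable_funP.
- by apply: measurable_funTS; exact/measurable_EFinP.
- by apply: filterS wv => x wx _; rewrite funeposE wx maxEle lee_fin leNgt v0.
Qed.

Lemma weight_integralE A : measurable A ->
  \int[mu]_(x in A) w x = \int[mu]_(x in A) (v x)%:E.
Proof.
move=> mA; apply: ae_eq_integral => //.
- by apply/measurable_funTS; exact: measurable_funP.
- by apply: measurable_funTS; exact/measurable_EFinP.
- by apply: filterS wv => x wx _.
Qed.

Lemma dual_weight_integralE (p : R) A : (1 < p)%R -> measurable A ->
  \int[mu]_(x in A) w x `^ (1 - fine (hoelder_conjugate p%:E))%R =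
  \int[mu]_(x in A) (dual_weight v p x)%:E.
Proof.
move=> p1 mA.
have -> : (1 - fine (hoelder_conjugate p%:E) = - (p - 1)^-1)%R.
  rewrite /hoelder_conjugate/= eqe gt_eqF ?(lt_trans ltr01)// -EFinB inver.
  rewrite subr_eq0 gt_eqF//=; field.
  by rewrite subr_eq0 gt_eqF.
apply: ae_eq_integral => //.
- apply/measurable_funTS; apply: (measurableT_comp (measurable_poweR _)).
  exact: measurable_funP.
- by apply: measurable_funTS; exact/measurable_EFinP/measurable_dual_weight.
- by apply: filterS wv => x wx _; rewrite wx poweR_EFin.
Qed.

End RealWeight.

Section MuckenhouptBalls.
Context d (R : realType) (X : completeBorelMetricType d R).
Variables (mu : {measure set X -> \bar R}) (w : {mfun X >-> \bar R}) (p : R).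
Hypotheses (dbl : doubling mu) (p1 : (1 < p)%R).
Hypothesis w_Ap : Muckenhoupt mu p (metric_balls X) w.
Variable v : X -> R.
Hypotheses (mv : measurable_fun setT v) (v0 : forall x, (0 < v x)%R).
Hypothesis wv : {ae mu, forall x, w x = (v x)%:E}.
Local Open Scope ereal_scope.

Local Notation sigma B := (\int[mu]_(y in B) (dual_weight v p y)%:E).

(** The Muckenhoupt condition multiplied out by [mu (ball x r) `^ p]. *)
Lemma Muckenhoupt_ball : exists2 M : R, (0 < M)%R &
  forall x r, (0 < r)%R ->
    weighted_measure mu w (ball x r) * sigma (ball x r) `^ (p - 1) <=
    (M * fine (mu (ball x r)) `^ p)%:E.
Proof.
have [M M0 HM] : exists2 M : R, (0 < M)%R & forall x r, (0 < r)%R ->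
    average mu w (ball x r) *
    average mu (fun x => w x `^ (1 - fine (hoelder_conjugate p%:E))%R) (ball x r)
      `^ (p - 1) <= M%:E.
  move: w_Ap; rewrite /Muckenhoupt/=; set S := (X in ereal_sup X) => Slty.
  exists (Num.max 1 (fine (ereal_sup S)))%R; first by rewrite lt_max ltr01.
  move=> x r r0; apply: (@le_trans _ _ (ereal_sup S)).
    by apply: ereal_sup_ubound; exists (ball x r) => //; exists x, r.
  case: (ereal_sup S) Slty => [s _|//|_]; last exact: leNye.
  by rewrite lee_fin le_max lexx orbT.
exists M => // x r r0.
have mB := measurable_mball x r.
have c0 : (0 < fine (mu (ball x r)))%R.
  by rewrite fine_gt0// (measure_ball_gt0 dbl)// ltey_eq (measure_ball_fin dbl).
have := HM x r r0; rewrite /average.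
rewrite (weight_integralE mv wv)// (dual_weight_integralE mv wv)//.
rewrite (weighted_measureE mv v0 wv)//.
rewrite -{1 2}(fineK (measure_ball_fin dbl x r)) inver gt_eqF//.
set c := fine _ in c0 *; set I := \int[mu]_(y in _) (v y)%:E.
have I0 : 0 <= I by apply: integral_ge0 => y _; rewrite lee_fin ltW.
have J0 : 0 <= sigma (ball x r).
  by apply: integral_ge0 => y _; rewrite lee_fin ltW// dual_weight_gt0.
have ci0 : 0 <= (c^-1)%:E by rewrite lee_fin invr_ge0 ltW.
rewrite (poweRM _ ci0 J0) poweR_EFin muleACA -EFinM.
have -> : (c^-1 * c^-1 `^ (p - 1) = (c `^ p)^-1)%R.
  rewrite (mulr_powRB1 _ (lt_trans ltr01 p1)) ?invr_ge0 ?ltW//.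
  by rewrite -[in LHS]powR_inv1 ?ltW// -powRrM mulN1r powRN.
by rewrite lee_pdivrMl ?powR_gt0// -EFinM mulrC.
Qed.

End MuckenhouptBalls.

(** * Auxiliary facts on integrals and on Lipschitz functions *)

(** For [f = 1] this bounds the difference of the measures of two sets, so that one
lemma controls both the numerator and the denominator of an average. *)
Lemma abse_integral_setY d (T : measurableType d) (R : realType)
    (m : {measure set T -> \bar R}) (A B : set T) (f : T -> R) :
  measurable A -> measurable B ->
  m.-integrable A (EFin \o f) -> m.-integrable B (EFin \o f) ->
  (`|\int[m]_(x in A) (f x)%:E - \int[m]_(x in B) (f x)%:E| <=
   \int[m]_(x in A `+` B) `|f x|%:E)%E.
Proof.
move=> mA mB iA iB; rewrite 2!(integral_mkcond _ (EFin \o f)).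
have iA' : m.-integrable setT ((EFin \o f) \_ A) by rewrite -integrable_mkcond.
have iB' : m.-integrable setT ((EFin \o f) \_ B) by rewrite -integrable_mkcond.
rewrite -integralB//; apply: le_trans (le_abse_integral _ _ _) _ => //.
  by have /integrableP[] := integrableB measurableT iA' iB'.
rewrite [leRHS]integral_mkcond le_eqVlt; apply/orP; left; apply/eqP.
apply: eq_integral => x _; rewrite !patchE.
have -> : (x \in A `+` B) = (x \in A) (+) (x \in B).
  rewrite /setY in_setU !in_setD.
  by case: (x \in A); case: (x \in B).
by case: (x \in A); case: (x \in B); rewrite /= ?subrr ?subr0 ?sub0r ?normrN ?normr0.
Qed.

Lemma integral_pos_gt0 d (T : measurableType d) (R : realType)
    (m : {measure set T -> \bar R}) (A : set T) (f : T -> R) :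
  measurable A -> measurable_fun setT f -> (forall x, 0 < f x) ->
  (0 < m A -> 0 < \int[m]_(x in A) (f x)%:E)%E.
Proof.
move=> mA mf f0 A0; rewrite lt_neqAle integral_ge0 ?andbT; last first.
  by move=> x _; rewrite lee_fin ltW.
apply/negP => /eqP/esym int0.
have mfA : measurable_fun A (EFin \o f) by exact/measurable_funTS/measurable_EFinP.
have : (\int[m]_(x in A) `|(EFin \o f) x| = 0)%E.
  by rewrite -int0; apply: eq_integral => x _; rewrite gee0_abs// lee_fin ltW.
move=> /(ae_eq_integral_abs m mA mfA)[N [mN N0 sub]].
have : (m A <= m N)%E.
  apply: le_measure; rewrite ?inE// => x Ax; apply: sub => /(_ Ax)[fx0].
  by have := f0 x; rewrite fx0 ltxx.
by rewrite N0 leNgt A0.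
Qed.

Section BorelMeasurability.
Context d (R : realType) (X : completeBorelMetricType d R).

Lemma measurable_of_continuous (g : X -> R) :
  (forall x e, 0 < e -> exists2 s : R, 0 < s &
     forall y, mdist x y < s -> `|g x - g y| <= e) -> measurable_fun setT g.
Proof.
move=> gc; apply: (measurability _ (RGenOInfty.measurableE R)) => _ [_ [a ->] <-].
rewrite setTI; apply: open_measurable_borel; rewrite openE => x /=.
rewrite in_itv/= andbT => agx.
have [s s0 sP] := gc x ((g x - a) / 2) ltac:(by rewrite divr_gt0// subr_gt0).
apply/nbhs_ballP; exists s => // y /in_ball/sP/=; rewrite in_itv/= andbT.
by move=> /(le_trans (ler_norm _)); lra.
Qed.

Lemma measurable_lipschitz (g : X -> R) (L : R) :
  (forall x y, `|g x - g y| <= L * mdist x y) -> measurable_fun setT g.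
Proof.
move=> gL; apply: measurable_of_continuous => x e e0.
have L1 : 0 < `|L| + 1 by rewrite ltr_wpDl.
exists (e / (`|L| + 1)); first by rewrite divr_gt0.
move=> y; rewrite ltr_pdivlMr// => xy; apply: le_trans (gL x y) _.
have := ler_wpM2r (mdist_ge0 x y) (ler_norm L).
by have := mdist_ge0 x y; lra.
Qed.

End BorelMeasurability.

Section DistanceToComplement.
Context d (R : realType) (X : completeBorelMetricType d R).
Variable U : set X.

(** The distance to the complement of [U], truncated at 1 so that it is finite
even if [U] is the whole space. *)
Definition depth (x : X) : R :=
  sup [set s : R | 0 <= s <= 1 /\ ball x s `<=` U].

Lemma depth_has_sup x : has_sup [set s : R | 0 <= s <= 1 /\ ball x s `<=` U].
Proof.
split; last by exists 1 => s [/andP[]].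
exists 0; split; first by rewrite lexx ler01.
by move=> y /in_ball; rewrite ltNge mdist_ge0.
Qed.

Lemma depth_ge0 x : 0 <= depth x.
Proof.
apply: sup_upper_bound (depth_has_sup x) _ _.
split; first by rewrite lexx ler01.
by move=> y /in_ball; rewrite ltNge mdist_ge0.
Qed.

Lemma depth_lipschitz x y : `|depth x - depth y| <= mdist x y.
Proof.
have sub z t : depth z - depth t <= mdist z t.
  rewrite lerBlDr; apply: sup_le_ub; first by have [] := depth_has_sup z.
  move=> s [/andP[s0 s1] sU].
  have [zs|zs] := leP s (mdist z t).
    by rewrite (le_trans zs)// lerDl depth_ge0.
  rewrite -lerBlDl; apply: sup_upper_bound (depth_has_sup t) _ _; split.
    by rewrite subr_ge0 (ltW zs)/= (le_trans _ s1)// gerBl mdist_ge0.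
  apply: subset_trans sU; apply: mball_subset; lra.
rewrite ler_norml sub andbT lerNl opprB metric_sym; exact: sub.
Qed.

Lemma depth_out x : ~ U x -> depth x = 0.
Proof.
move=> nU; apply/eqP; rewrite eq_le depth_ge0 andbT.
apply: sup_le_ub; first by have [] := depth_has_sup x.
move=> s [_ sU]; rewrite leNgt; apply/negP => s0; apply/nU/sU/in_ball.
by rewrite mdistxx.
Qed.

Lemma depth_gt0 x : open U -> U x -> 0 < depth x.
Proof.
rewrite openE => oU /oU/nbhs_ballP[e /= e0 eU].
apply: (@lt_le_trans _ _ (Num.min 1 e)); first by rewrite lt_min ltr01.
apply: sup_upper_bound (depth_has_sup x) _ _; split.
  by rewrite le_min ler01 (ltW e0)/= ge_min lexx.
apply: subset_trans eU; apply: mball_subset.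
by rewrite mdistxx add0r ge_min lexx orbT.
Qed.

End DistanceToComplement.

(** * Limits of suprema over a family *)

Lemma sup_nonneg_leP (R : realType) (A : set (\bar R)) (e : \bar R) : (0 <= e)%E ->
  (sup_nonneg A <= e)%E <-> forall a, A a -> (a <= e)%E.
Proof.
move=> e0; split=> [h a Aa|h].
  by apply: le_trans h; apply: ereal_sup_ubound; right.
by apply: ub_ereal_sup => a [->//|]; exact: h.
Qed.

Lemma sup_nonneg_ge0 (R : realType) (A : set (\bar R)) : (0 <= sup_nonneg A)%E.
Proof. by apply: ereal_sup_ubound; left. Qed.

Lemma nneg_cvg0P (R : realType) (I : Type) (F : set_system I) (FF : Filter F)
    (u : I -> \bar R) : (forall i, 0 <= u i)%E ->
  u i @[i --> F] --> 0%E <->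
  forall e : R, 0 < e -> \forall i \near F, (u i <= e%:E)%E.
Proof.
move=> u0; split=> [cu e e0|H].
  have : \forall i \near F, (u i < e%:E)%E.
    apply: (cu [set z | (z < e%:E)%E]); apply: open_nbhs_nbhs.
    by split; [exact: open_ereal_lt_ereal|rewrite /= lte_fin].
  by apply: filterS => i /ltW.
apply/fine_cvgP; split.
  by apply: filterS (H 1 ltr01) => i ui; rewrite ge0_fin_numE// (le_lt_trans ui)// ltry.
apply/cvgr0Pnorm_le => e e0; apply: filterS (H e e0) => i ui.
rewrite /= ger0_norm ?fine_ge0// -lee_fin fineK//.
by rewrite ge0_fin_numE// (le_lt_trans ui)// ltry.
Qed.

(** * Averages over balls in the weighted space *)

Section WeightedAverages.
Context d (R : realType) (X : completeBorelMetricType d R).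
(** [v] is a version of the weight with positive finite values everywhere, and [M] is
the constant of the Muckenhoupt condition. *)
Variables (mu nu : {measure set X -> \bar R}) (v : X -> R) (p M : R).
Hypotheses (dbl : doubling mu) (p1 : 1 < p) (M0 : 0 < M).
Hypotheses (mv : measurable_fun setT v) (v0 : forall x, 0 < v x).
Local Open Scope ereal_scope.
Local Notation sigma B := (\int[mu]_(y in B) (dual_weight v p y)%:E).
Hypothesis nuE : forall A, measurable A -> nu A = \int[mu]_(x in A) (v x)%:E.
Hypothesis Ap : forall x r, (0 < r)%R ->
  nu (ball x r) * sigma (ball x r) `^ (p - 1) <=
  (M * fine (mu (ball x r)) `^ p)%:E.

Let p0 : (0 < p)%R. Proof. exact: lt_trans p1. Qed.

Let pp0 : (0 < p - 1)%R. Proof. by rewrite subr_gt0. Qed.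

Let sigma_ge0 B : 0 <= sigma B.
Proof. by apply: integral_ge0 => x _; rewrite lee_fin ltW// dual_weight_gt0. Qed.

Let mu_fine_gt0 (x : X) r : (0 < r)%R -> (0 < fine (mu (ball x r)))%R.
Proof.
by move=> r0; rewrite fine_gt0// (measure_ball_gt0 dbl)// ltey_eq (measure_ball_fin dbl).
Qed.

Lemma weighted_ball_gt0 (x : X) r : (0 < r)%R -> 0 < nu (ball x r).
Proof.
move=> r0; rewrite nuE; last exact: measurable_mball.
apply: integral_pos_gt0 => //; first exact: measurable_mball.
exact: measure_ball_gt0.
Qed.

Let sigma_ball_gt0 (x : X) r : (0 < r)%R -> 0 < sigma (ball x r).
Proof.
move=> r0; apply: integral_pos_gt0.
- exact: measurable_mball.
- exact: measurable_dual_weight.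
- exact: dual_weight_gt0.
- exact: measure_ball_gt0.
Qed.

(** In the Muckenhoupt inequality a product of two positive factors is finite, so
both factors are. *)
Lemma weighted_ball_fin (x : X) r : (0 < r)%R -> nu (ball x r) \is a fin_num.
Proof.
move=> r0; rewrite ge0_fin_numE// ltey; apply/eqP => nuoo.
have := Ap x r0; rewrite nuoo gt0_mulye ?leye_eq//.
exact/poweR_gt0/sigma_ball_gt0.
Qed.

Lemma dual_weight_ball_fin (x : X) r : (0 < r)%R -> sigma (ball x r) \is a fin_num.
Proof.
move=> r0; rewrite ge0_fin_numE// ltey; apply/eqP => soo.
have := Ap x r0; rewrite soo poweRyr ?gt_eqF// gt0_muley ?leye_eq//.
exact: weighted_ball_gt0.
Qed.

Lemma ball_average_le (x : X) r (f : X -> R) : (0 < r)%R -> measurable_fun setT f ->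
  (\int[mu]_(y in ball x r) `|f y|%:E) `^ p * nu (ball x r) <=
  (M * fine (mu (ball x r)) `^ p)%:E * \int[nu]_(y in ball x r) (`|f y| `^ p)%:E.
Proof.
move=> r0 mf; have mB := measurable_mball x r.
have I0 : 0 <= \int[nu]_(y in ball x r) (`|f y| `^ p)%:E.
  by apply: integral_ge0 => y _; rewrite lee_fin powR_ge0.
apply: le_trans (_ : _ <= (\int[nu]_(y in ball x r) (`|f y| `^ p)%:E *
    sigma (ball x r) `^ (p - 1)) * nu (ball x r)) _.
  by rewrite lee_wpmul2r//; exact: weighted_hoelder.
by rewrite -muleA muleC lee_wpmul2r// muleC Ap.
Qed.

(** Testing the averages on the indicator of the smaller ball. *)
Lemma weighted_doubling : doubling nu.
Proof.
have [C C0 CP] := doubling_const dbl; exists (M * C `^ p)%R => x r r0.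
have r20 : (0 < 2 * r)%R by rewrite mulr_gt0.
split; first exact: weighted_ball_gt0.
have cb := mu_fine_gt0 x r0.
apply/andP; split; last first.
  by rewrite -(fineK (weighted_ball_fin x r0)) -EFinM ltry.
have sub : ball x r `<=` ball x (2 * r)%R.
  by apply: mball_subset; rewrite mdistxx; lra.
have mB := measurable_mball x r; have mB2 := measurable_mball x (2 * r)%R.
have mI : measurable_fun setT (\1_(ball x r) : X -> R) by exact: measurable_indic.
have := ball_average_le x r20 mI.
have -> : \int[mu]_(y in ball x (2 * r)%R) `|\1_(ball x r) y : R|%:E = mu (ball x r).
  under eq_integral => y _ do rewrite ger0_norm//.
  by rewrite integral_indic// setIidl.
have -> : \int[nu]_(y in ball x (2 * r)%R) (`|\1_(ball x r) y : R| `^ p)%:E =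
    nu (ball x r).
  rewrite -[in RHS](setIidl sub) -integral_indic//; apply: eq_integral => y _.
  by rewrite indicE; case: (_ \in _); rewrite ?normr1 ?powR1// normr0 powR0// gt_eqF.
rewrite -{1}(fineK (measure_ball_fin dbl x r)) poweR_EFin.
rewrite -(fineK (weighted_ball_fin x r0)) -(fineK (weighted_ball_fin x r20)).
have cc : (fine (mu (ball x (2 * r))) <= C * fine (mu (ball x r)))%R.
  rewrite -lee_fin EFinM !fineK ?(measure_ball_fin dbl)//; exact: CP.
rewrite -!EFinM !lee_fin => h.
have cp : (0 < fine (mu (ball x r)) `^ p)%R by rewrite powR_gt0.
rewrite -(ler_pM2l cp); apply: (le_trans h).
rewrite [leRHS](_ : _ = M * (C `^ p * fine (mu (ball x r)) `^ p) *
  fine (nu (ball x r)))%R; last by ring.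
rewrite ler_wpM2r ?fine_ge0//.
rewrite ler_wpM2l ?(ltW M0)// -powRM ?(ltW C0) ?(ltW cb)//.
apply: ge0_ler_powR; rewrite ?nnegrE ?(ltW p0) ?fine_ge0//.
by rewrite mulr_ge0 ?(ltW C0) ?(ltW cb).
Qed.

Lemma Lp_integrable_ball (x : X) r (f : X -> R) : (0 < r)%R ->
  measurable_fun setT f -> \int[nu]_y (`|f y| `^ p)%:E < +oo ->
  mu.-integrable (ball x r) (EFin \o f).
Proof.
move=> r0 mf fp; have mB := measurable_mball x r.
apply/integrableP; split; first exact/measurable_funTS/measurable_EFinP.
apply: (@lty_poweRy _ _ p); first by rewrite gt_eqF.
apply: le_lt_trans (weighted_hoelder mv v0 p1 nuE mB mf) _.
have fB : \int[nu]_(y in ball x r) (`|f y| `^ p)%:E < +oo.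
  apply: le_lt_trans fp; apply: ge0_subset_integral => //.
  exact: measurable_powR_norm.
apply: lte_mul_pinfty => //.
- by apply: integral_ge0 => y _; rewrite lee_fin powR_ge0.
- by rewrite ge0_fin_numE// integral_ge0// => y _; rewrite lee_fin powR_ge0.
- by apply: poweR_lty; rewrite ltey_eq dual_weight_ball_fin.
Qed.

Definition ball_average r (f : X -> R) (x : X) : R :=
  fine (average mu (EFin \o f) (ball x r)).

Lemma averageE (x : X) r (f : X -> R) : (0 < r)%R ->
  average mu (EFin \o f) (ball x r) =
  (fine (mu (ball x r)))^-1%:E * \int[mu]_(y in ball x r) (f y)%:E.
Proof.
move=> r0; rewrite /average -{1}(fineK (measure_ball_fin dbl x r)) inver gt_eqF//.
exact: mu_fine_gt0.
Qed.

Lemma ball_averageE (x : X) r (f : X -> R) : (0 < r)%R ->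
  mu.-integrable (ball x r) (EFin \o f) ->
  average mu (EFin \o f) (ball x r) = (ball_average r f x)%:E.
Proof.
move=> r0 fi; rewrite /ball_average fineK// averageE// fin_numM//.
by apply: integrable_fin_num => //; exact: measurable_mball.
Qed.

Lemma ball_averageB (x : X) r (f g : X -> R) : (0 < r)%R ->
  mu.-integrable (ball x r) (EFin \o f) -> mu.-integrable (ball x r) (EFin \o g) ->
  ball_average r (fun y => f y - g y)%R x = (ball_average r f x - ball_average r g x)%R.
Proof.
move=> r0 fi gi; have mB := measurable_mball x r.
have fgi : mu.-integrable (ball x r) (EFin \o (fun y => f y - g y)%R).
  exact: (integrableB mB fi gi).
apply: EFin_inj; rewrite EFinB -!ball_averageE// !averageE//.
have -> : \int[mu]_(y in ball x r) (f y - g y)%:E =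
    \int[mu]_(y in ball x r) (f y)%:E - \int[mu]_(y in ball x r) (g y)%:E.
  by rewrite -integralB//.
rewrite muleBr// fin_num_adde_defr//.
by apply: integrable_fin_num.
Qed.

(** The Muckenhoupt condition enters the sequel in this form: the average for [mu]
is dominated by an average for the doubling measure [nu]. *)
Lemma ball_average_powR_le (x : X) r (f : X -> R) : (0 < r)%R ->
  measurable_fun setT f -> mu.-integrable (ball x r) (EFin \o f) ->
  (`|ball_average r f x| `^ p)%:E <=
  M%:E * ((fine (nu (ball x r)))^-1%:E * \int[nu]_(y in ball x r) (`|f y| `^ p)%:E).
Proof.
move=> r0 mf fi; have mB := measurable_mball x r.
have cb := mu_fine_gt0 x r0.
have nb : (0 < fine (nu (ball x r)))%R.
  by rewrite fine_gt0// weighted_ball_gt0// ltey_eq weighted_ball_fin.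
have := ball_average_le x r0 mf.
rewrite -[X in _ * X <= _](fineK (weighted_ball_fin x r0)) => h.
have If : \int[mu]_(y in ball x r) `|f y|%:E \is a fin_num.
  by apply: integrable_fin_num => //; exact: (integrable_abse fi).
rewrite muleCA lee_pdivlMl// muleC.
have {}h : ((fine (mu (ball x r)) `^ p)^-1)%:E *
    ((\int[mu]_(y in ball x r) `|f y|%:E) `^ p * (fine (nu (ball x r)))%:E) <=
    M%:E * \int[nu]_(y in ball x r) (`|f y| `^ p)%:E.
  by rewrite lee_pdivrMl ?powR_gt0// muleA -EFinM mulrC.
apply: le_trans h; rewrite muleA lee_wpmul2r ?lee_fin ?(ltW nb)//.
rewrite -(fineK If) poweR_EFin -EFinM lee_fin.
have -> : ((fine (mu (ball x r)) `^ p)^-1 * fine (\int[mu]_(y in ball x r) `|f y|%:E) `^ p =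
    ((fine (mu (ball x r)))^-1 * fine (\int[mu]_(y in ball x r) `|f y|%:E)) `^ p)%R.
  rewrite powRM ?invr_ge0 ?(ltW cb) ?fine_ge0 ?integral_ge0//.
  by rewrite -(powR_inv1 (ltW cb)) -powRrM mulN1r powRN.
have Ifg : 0 <= \int[mu]_(y in ball x r) `|f y|%:E by exact: integral_ge0.
apply: ge0_ler_powR; rewrite ?nnegrE ?(ltW p0) ?mulr_ge0 ?invr_ge0 ?(ltW cb) ?fine_ge0//.
rewrite -lee_fin -abse_EFin -ball_averageE// averageE// abseM EFinM fineK//.
rewrite abse_EFin ger0_norm ?invr_ge0 ?(ltW cb)//.
rewrite lee_wpmul2l ?lee_fin ?invr_ge0 ?(ltW cb)//.
by apply: le_abse_integral => //; exact/measurable_funTS/measurable_EFinP.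
Qed.

(** ** Equicontinuity of the averages *)

Hypothesis mu_cont : metrically_continuous mu.

Lemma integral_le_dual_weight E (f : X -> R) (L s : R) : (0 <= L)%R -> (0 <= s)%R ->
  measurable E -> measurable_fun setT f ->
  \int[nu]_y (`|f y| `^ p)%:E <= L%:E -> sigma E <= s%:E ->
  \int[mu]_(y in E) `|f y|%:E <= ((L * s `^ (p - 1)) `^ p^-1)%:E.
Proof.
move=> L0 s0 mE mf fL sE.
have inI (x : \bar R) : 0 <= x -> x \in `[0, +oo] by move=> x0; rewrite in_itv/= x0 leey.
have I0 : 0 <= \int[mu]_(y in E) `|f y|%:E by exact: integral_ge0.
have h : (\int[mu]_(y in E) `|f y|%:E) `^ p <= (L * s `^ (p - 1))%:E.
  apply: le_trans (weighted_hoelder mv v0 p1 nuE mE mf) _.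
  rewrite EFinM; apply: lee_pmul.
  - by apply: integral_ge0 => y _; rewrite lee_fin powR_ge0.
  - exact: poweR_ge0.
  - apply: le_trans fL; apply: ge0_subset_integral => //.
    exact: measurable_powR_norm.
  - rewrite -poweR_EFin; apply: (gt0_ler_poweR (ltW pp0)) => //; apply: inI => //.
have ip0 : (0 <= p^-1)%R by rewrite invr_ge0 ltW.
have Ls0 : 0 <= (L * s `^ (p - 1))%:E by rewrite lee_fin mulr_ge0// powR_ge0.
have := gt0_ler_poweR ip0 (inI _ (poweR_ge0 _ _)) (inI _ Ls0) h.
by rewrite -poweRrM divff ?gt_eqF// poweRe1.
Qed.

(** The constant depends on [f] through its norm only. *)
Lemma small_dual_weight_integral (L e : R) : (0 < L)%R -> (0 < e)%R ->
  exists2 s : R, (0 < s)%R & forall E (f : X -> R), measurable E ->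
    measurable_fun setT f -> \int[nu]_y (`|f y| `^ p)%:E <= L%:E ->
    sigma E <= s%:E -> \int[mu]_(y in E) `|f y|%:E <= e%:E.
Proof.
move=> L0 e0; exists ((e `^ p / L) `^ (p - 1)^-1)%R.
  by rewrite powR_gt0// divr_gt0// powR_gt0.
move=> E f mE mf fL sE.
have := integral_le_dual_weight (ltW L0) (powR_ge0 _ _) mE mf fL sE.
rewrite -powRrM mulVf ?gt_eqF// powRr1 ?divr_ge0 ?powR_ge0 ?(ltW L0)//.
by rewrite mulrCA divff ?gt_eqF// mulr1 -powRrM divff ?gt_eqF// powRr1// ltW.
Qed.

Lemma dual_weight_abs_continuous (x : X) r e : (0 < r)%R -> (0 < e)%R ->
  exists2 s : R, (0 < s)%R & forall E, measurable E -> E `<=` ball x r ->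
    mu E < s%:E -> sigma E <= e%:E.
Proof.
move=> r0 e0; have mB := measurable_mball x r.
pose h := (dual_weight v p) \_ (ball x r).
have mh : measurable_fun setT h.
  apply/(measurable_restrictT _ mB)/measurable_funTS; exact: measurable_dual_weight.
have h0 y : (0 <= h y)%R.
  by rewrite /h patchE; case: ifP => // _; exact/ltW/dual_weight_gt0.
have hE E : E `<=` ball x r -> \int[mu]_(y in E) (h y)%:E = sigma E.
  move=> sub; apply: eq_integral => y /set_mem/sub yB.
  by rewrite /h patchE mem_set.
have ih : mu.-integrable setT (EFin \o h).
  apply/integrableP; split; first exact/measurable_EFinP.
  rewrite (_ : \int[mu]_y _ = sigma (ball x r)).
    by rewrite ltey_eq (dual_weight_ball_fin).
  rewrite [RHS]integral_mkcond; apply: eq_integral => y _.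
  by rewrite /= ger0_norm// /h !patchE; case: ifP.
have [s [s0 sP]] := integral_normr_continuous ih e0; exists s => // E mE sub Es.
have := sP E mE Es; rewrite /Rintegral.
under eq_integral => y _ do rewrite ger0_norm//.
rewrite hE// => h1.
have sfin : sigma E \is a fin_num.
  rewrite ge0_fin_numE//; apply: le_lt_trans (_ : _ <= sigma (ball x r)) _.
    apply: ge0_subset_integral => //.
      exact/measurable_funTS/measurable_EFinP/measurable_dual_weight.
    by move=> y _; rewrite lee_fin ltW// dual_weight_gt0.
  by rewrite ltey_eq (dual_weight_ball_fin).
by rewrite -(fineK sfin) lee_fin ltW.
Qed.

Let quotient_close (I I' b b' S t e : R) : (0 < b)%R -> (0 < e)%R -> (0 <= S)%R ->
  (`|I - I'| <= e * b / 2 -> `|b - b'| <= t -> `|I'| <= S ->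
   t <= b / 2 -> t * (4 * (S + 1)) <= e * b ^+ 2 ->
  `|b^-1 * I - b'^-1 * I'| <= e)%R.
Proof.
move=> b0 e0 S0 hI hb hI' tb tS.
have bb' : (b / 2 <= b')%R by have := le_trans (ler_norm _) hb; lra.
have b'0 : (0 < b')%R by apply: lt_le_trans bb'; rewrite divr_gt0.
have t0 : (0 <= t)%R by exact: le_trans hb.
(* The numerators are compared over the common denominator [b]. *)
have -> : (b^-1 * I - b'^-1 * I' = (I - I') / b + I' * (b' - b) / (b * b'))%R.
  by field; rewrite !gt_eqF.
rewrite (le_trans (ler_normD _ _))// [leRHS]splitr lerD//.
  rewrite normrM normfV (gtr0_norm b0) ler_pdivrMr//.
  by rewrite mulrAC.
rewrite normrM normfV normrM (gtr0_norm (mulr_gt0 b0 b'0)) ler_pdivrMr ?mulr_gt0//.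
apply: (@le_trans _ _ (S * t)%R); first by rewrite ler_pM// distrC.
apply: (@le_trans _ _ (e * b ^+ 2 / 4)%R).
  rewrite ler_pdivlMr//; apply: le_trans tS.
  have : (S * t <= (S + 1) * t)%R by rewrite ler_wpM2r// lerDl.
  lra.
have : (b * (b / 2) <= b * b')%R by rewrite ler_wpM2l// ltW.
move=> /(ler_wpM2l (ltW e0)); rewrite expr2; lra.
Qed.

(** A bounded family of [Lp] is averaged to an equicontinuous one: the integrals
over the symmetric difference of two balls are small uniformly in [f]. *)
Lemma ball_average_equicontinuous (x : X) r (L e : R) :
  (0 < r)%R -> (0 < L)%R -> (0 < e)%R ->
  exists2 s : R, (0 < s)%R & forall y (f : X -> R), (mdist x y < s)%R ->
    measurable_fun setT f -> \int[nu]_z (`|f z| `^ p)%:E <= L%:E ->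
    (`|ball_average r f x - ball_average r f y| <= e)%R.
Proof.
move=> r0 L0 e0; have r20 : (0 < 2 * r)%R by rewrite mulr_gt0.
have b0 := mu_fine_gt0 x r0; set b := fine (mu (ball x r)) in b0.
have sfin := dual_weight_ball_fin x r20.
pose S := ((L * fine (sigma (ball x (2 * r)%R)) `^ (p - 1)) `^ p^-1)%R.
have S0 : (0 <= S)%R by exact: powR_ge0.
have eb0 : (0 < e * b / 2)%R by rewrite divr_gt0// mulr_gt0.
have [s1 s10 s1P] := small_dual_weight_integral L0 eb0.
have [s2 s20 s2P] := dual_weight_abs_continuous x r20 s10.
pose t := Num.min (b / 2)%R (e * b ^+ 2 / (4 * (S + 1)))%R.
have S10 : (0 < 4 * (S + 1))%R by rewrite mulr_gt0// ltr_wpDl.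
have t0 : (0 < t)%R.
  by rewrite lt_min divr_gt0//= divr_gt0// mulr_gt0// exprn_gt0.
have nb : \forall y \near x, mu (ball x r `+` ball y r) < (Num.min s2 t)%:E.
  have := @mu_cont x r r0 [set z | z < (Num.min s2 t)%:E]; apply.
  apply: open_nbhs_nbhs; split; first exact: open_ereal_lt_ereal.
  by rewrite /= lte_fin lt_min s20.
have [s3 /= s30 s3P] := (nbhs_ballP _ _).1 nb.
exists (Num.min s3 r); first by rewrite lt_min s30.
move=> y f; rewrite lt_min => /andP[xys3 xyr] mf fL.
have Lf : \int[nu]_z (`|f z| `^ p)%:E < +oo by exact: le_lt_trans fL (ltry _).
have mBx := measurable_mball x r; have mBy := measurable_mball y r.
have mD : measurable (ball x r `+` ball y r).
  by apply: measurableU; exact: measurableD.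
have subx : ball x r `<=` ball x (2 * r)%R by apply: mball_subset; rewrite mdistxx; lra.
have suby : ball y r `<=` ball x (2 * r)%R by apply: mball_subset; lra.
have subD : ball x r `+` ball y r `<=` ball x (2 * r)%R.
  by move=> z [] [+ _]; [exact: subx|exact: suby].
have := s3P y (ltac:(by apply/in_ball)); rewrite /= => muD.
have fx := Lp_integrable_ball x r0 mf Lf.
have fy := Lp_integrable_ball y r0 mf Lf.
have -> : ball_average r f x = (b^-1 * fine (\int[mu]_(z in ball x r) (f z)%:E))%R.
  rewrite /ball_average averageE// -[X in _ * X]fineK//.
  exact: integrable_fin_num.
have -> : ball_average r f y =
    ((fine (mu (ball y r)))^-1 * fine (\int[mu]_(z in ball y r) (f z)%:E))%R.
  rewrite /ball_average averageE// -[X in _ * X]fineK//.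
  exact: integrable_fin_num.
have fxf : \int[mu]_(z in ball x r) (f z)%:E \is a fin_num by exact: integrable_fin_num.
have fyf : \int[mu]_(z in ball y r) (f z)%:E \is a fin_num by exact: integrable_fin_num.
apply: (@quotient_close _ _ _ _ S t) => //.
- rewrite -lee_fin -abse_EFin EFinB !fineK//.
  apply: le_trans (abse_integral_setY mBx mBy fx fy) _.
  apply: s1P => //; apply: s2P => //.
  by apply: lt_le_trans muD _; rewrite lee_fin ge_min lexx.
- rewrite -lee_fin -abse_EFin EFinB !fineK ?(measure_ball_fin dbl)//.
  have intE (B : set X) : measurable B -> \int[mu]_(z in B) (cst 1 z : R)%:E = mu B.
    by move=> mB; have := integral_cst mu mB 1; rewrite mul1e => <-.
  have int1 (y' : X) : mu.-integrable (ball y' r) (EFin \o cst 1%R).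
    have mB := measurable_mball y' r; apply/integrableP; split.
      exact/measurable_EFinP/measurable_cst.
    under eq_integral => z _ do rewrite /= normr1.
    by rewrite intE// ltey_eq (measure_ball_fin dbl).
  have := abse_integral_setY mBx mBy (int1 x) (int1 y).
  rewrite !intE// => /le_trans; apply.
  under eq_integral => z _ do rewrite normr1.
  rewrite intE//; apply: (le_trans (ltW muD)).
  by rewrite lee_fin ge_min lexx orbT.
- rewrite -lee_fin -abse_EFin fineK//.
  apply: le_trans (le_abse_integral _ _ _) _ => //.
    exact/measurable_funTS/measurable_EFinP.
  apply: le_trans (_ : _ <= \int[mu]_(z in ball x (2 * r)%R) `|f z|%:E) _.
    apply: ge0_subset_integral => //; first exact: measurable_mball.
    by apply/measurable_funTS; apply: measurableT_comp => //; exact/measurable_EFinP.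
  apply: integral_le_dual_weight => //.
  - exact: ltW.
  - by rewrite fine_ge0.
  - exact: measurable_mball.
  - by rewrite fineK.
- by rewrite /t ge_min lexx.
- by rewrite -ler_pdivlMr// /t ge_min lexx orbT.
Qed.

(** ** Boundedness in Lp *)

Local Notation N f := ('N[nu]_p%:E[EFin \o f]).

Lemma Lnorm_finE (f : X -> R) : N f < +oo -> exists2 c : R, (0 <= c)%R & N f = c%:E.
Proof.
move=> Nf; exists (fine (N f)); first by rewrite fine_ge0// Lnorm_ge0.
by rewrite fineK// ge0_fin_numE// Lnorm_ge0.
Qed.

Lemma Lp_ball_integrable (x : X) r (f : X -> R) : (0 < r)%R ->
  measurable_fun setT f -> N f < +oo -> mu.-integrable (ball x r) (EFin \o f).
Proof.
move=> r0 mf; rewrite Lnorm_lty// => Nf.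
exact: (Lp_integrable_ball x r0 mf Nf).
Qed.

Lemma measurable_ball_average r (f : X -> R) : (0 < r)%R ->
  measurable_fun setT f -> N f < +oo -> measurable_fun setT (ball_average r f).
Proof.
move=> r0 mf /Lnorm_finE[c c0 Nf]; apply: measurable_of_continuous => x e e0.
have L0 : (0 < c `^ p + 1)%R by rewrite ltr_wpDl// powR_ge0.
have [s s0 sP] := ball_average_equicontinuous x r0 L0 e0.
exists s => // y xy; apply: sP => //.
apply: (@le_trans _ _ (c `^ p)%:E); last by rewrite lee_fin lerDl.
by rewrite -Lnorm_le// Nf.
Qed.

(** Uniformity in the radius comes from the doubling property of [nu], through
[integral_average_le]. *)
Lemma ball_average_bounded : exists2 C : R, (0 < C)%R &
  forall r (f : X -> R), (0 < r)%R -> measurable_fun setT f -> N f < +oo ->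
    N (ball_average r f) <= C%:E * N f.
Proof.
have [D D0 DP] := integral_average_le weighted_doubling.
exists ((M * D) `^ p^-1)%R; first by rewrite powR_gt0// mulr_gt0.
move=> r f r0 mf Nf; have [c c0 Nc] := Lnorm_finE Nf.
have MD0 : (0 <= M * D)%R by rewrite mulr_ge0// ltW.
rewrite Nc -EFinM Lnorm_le// ?mulr_ge0 ?powR_ge0//.
rewrite (powRM _ (powR_ge0 _ _) c0) -powRrM mulVf ?gt_eqF// powRr1//.
have fc : \int[nu]_x (`|f x| `^ p)%:E <= (c `^ p)%:E by rewrite -Lnorm_le// Nc.
have mfp := measurable_powR_norm p mf.
have fp0 x : 0 <= (`|f x| `^ p)%:E by rewrite lee_fin powR_ge0.
have mk : measurable_fun setT (fun x : X => (fine (nu (ball x r)))^-1%:E).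
  apply/measurable_EFinP; rewrite (_ : (fun _ => _) =
    (fun x : X => fine (nu (ball x r)) `^ (-1))%R).
    apply: (measurableT_comp (measurable_powR (-1)%R)).
    by apply: measurableT_comp => //; exact: measurable_measure_ball weighted_doubling.
  by apply/funext => x; rewrite powR_inv1 ?fine_ge0.
have mkI : measurable_fun setT (fun x : X => (fine (nu (ball x r)))^-1%:E *
    \int[nu]_(y in ball x r) (`|f y| `^ p)%:E).
  apply: emeasurable_funM => //.
  exact: measurable_integral_ball weighted_doubling mfp fp0.
apply: (@le_trans _ _ (\int[nu]_x (M%:E * ((fine (nu (ball x r)))^-1%:E *
    \int[nu]_(y in ball x r) (`|f y| `^ p)%:E)))).
  apply: ge0_le_integral => //.
  - by apply: measurable_powR_norm; exact: measurable_ball_average.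
  - exact: measurable_funeM.
  - move=> x _; apply: ball_average_powR_le => //.
    exact: Lp_ball_integrable.
rewrite ge0_integralZl//; last 2 first.
- move=> x _; rewrite mule_ge0 ?lee_fin ?invr_ge0 ?fine_ge0//.
  by apply: integral_ge0 => y _.
- by rewrite lee_fin ltW.
apply: le_trans (_ : _ <= M%:E * (D%:E * \int[nu]_y (`|f y| `^ p)%:E)) _.
  by rewrite lee_wpmul2l ?lee_fin ?(ltW M0)//; exact: DP.
by rewrite muleA -EFinM [leRHS]EFinM lee_wpmul2l// lee_fin.
Qed.

(** ** Convergence in Lp *)

Definition averages_converge (f : X -> R) : Prop :=
  [/\ measurable_fun setT f, N f < +oo &
      forall e : R, (0 < e)%R -> exists2 r0 : R, (0 < r0)%R &
        forall r, (0 < r < r0)%R -> N (fun x => f x - ball_average r f x)%R <= e%:E].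

Lemma Lnorm_sub_lty (f g : X -> R) : measurable_fun setT f -> measurable_fun setT g ->
  N f < +oo -> N g < +oo -> N (fun x => f x - g x)%R < +oo.
Proof.
move=> mf mg Nf Ng; apply: le_lt_trans (Lnorm_sub_le nu p1 mf mg) _.
exact: lte_add_pinfty.
Qed.

Lemma ball_average_sub r (f g : X -> R) x : (0 < r)%R ->
  measurable_fun setT f -> measurable_fun setT g -> N f < +oo -> N g < +oo ->
  (ball_average r (fun y => f y - g y) x = ball_average r f x - ball_average r g x)%R.
Proof.
move=> r0 mf mg Nf Ng; apply: ball_averageB => //.
- exact: Lp_ball_integrable.
- exact: Lp_ball_integrable.
Qed.

Lemma averages_convergeB (f g : X -> R) : averages_converge f ->
  averages_converge g -> averages_converge (fun x => f x - g x)%R.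
Proof.
move=> [mf Nf fP] [mg Ng gP]; split.
- exact: measurable_funB.
- exact: Lnorm_sub_lty.
move=> e e0; have e2 : (0 < e / 2)%R by rewrite divr_gt0.
have [r1 r10 r1P] := fP _ e2; have [r2 r20 r2P] := gP _ e2.
exists (Num.min r1 r2); first by rewrite lt_min r10.
move=> r /andP[r0]; rewrite lt_min => /andP[rr1 rr2].
have := leeD (r1P r ltac:(by rewrite r0)) (r2P r ltac:(by rewrite r0)).
rewrite -EFinD -splitr; apply: le_trans.
rewrite (_ : EFin \o _ = EFin \o
    (fun x => (f x - ball_average r f x) - (g x - ball_average r g x))%R); last first.
  by apply/funext => x /=; rewrite ball_average_sub//; congr EFin; ring.
by apply: Lnorm_sub_le => //; apply: measurable_funB => //; exact: measurable_ball_average.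
Qed.

(** The averaging operators are uniformly bounded, so the set of functions on
which they converge is closed. *)
Lemma averages_converge_closed (f : X -> R) : measurable_fun setT f -> N f < +oo ->
  (forall e : R, (0 < e)%R -> exists2 g, averages_converge g &
     N (fun x => f x - g x)%R <= e%:E) -> averages_converge f.
Proof.
move=> mf Nf H; split=> // e e0.
have [C C0 CP] := ball_average_bounded.
pose e1 := (e / (2 + C))%R.
have C20 : (0 < 2 + C)%R by rewrite addr_gt0.
have e10 : (0 < e1)%R by rewrite divr_gt0.
have [g [mg Ng gP] fg] := H _ e10.
have [r0 r00 r0P] := gP _ e10; exists r0 => // r /andP[rp rr].
have h1 := r0P r ltac:(by rewrite rp).
have mfA := measurable_ball_average rp mf Nf; have mgA := measurable_ball_average rp mg Ng.
apply: le_trans (Lnorm_sub_triangle nu p1 mf mg mfA) _.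
apply: le_trans (_ : _ <= e1%:E + (e1%:E + (C * e1)%:E)) _; last first.
  rewrite -!EFinD lee_fin /e1 le_eqVlt; apply/orP; left; apply/eqP.
  by field; rewrite gt_eqF.
apply: leeD => //; apply: le_trans (Lnorm_sub_triangle nu p1 mg mgA mfA) _.
apply: leeD => //.
rewrite Lnorm_subC.
rewrite (_ : EFin \o _ = EFin \o ball_average r (fun x => f x - g x)%R); last first.
  by apply/funext => x /=; rewrite ball_average_sub.
apply: (@le_trans _ _ (C%:E * N (fun x => f x - g x)%R)).
  by apply: CP => //; [exact: measurable_funB|exact: Lnorm_sub_lty].
by rewrite EFinM lee_wpmul2l// lee_fin ltW.
Qed.

(** Dominated convergence, with [f] itself as the bound. *)
Lemma averages_converge_mono (g : nat -> X -> R) (f : X -> R) :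
  measurable_fun setT f -> N f < +oo ->
  (forall n, averages_converge (g n)) -> (forall n x, (0 <= g n x <= f x)%R) ->
  (forall x, g n x @[n --> \oo] --> f x) -> averages_converge f.
Proof.
move=> mf Nf gP gf gcvg; apply: averages_converge_closed => // e e0.
have mg n : measurable_fun setT (g n) by case: (gP n).
have f0 x : (0 <= f x)%R by have /andP[/le_trans] := gf 0%N x; apply.
pose h n x := (`|f x - g n x| `^ p)%:E.
have mh n : measurable_fun setT (h n).
  by apply: measurable_powR_norm; exact: measurable_funB.
have ifp : nu.-integrable setT (fun x => (`|f x| `^ p)%:E).
  apply/integrableP; split; first exact: measurable_powR_norm.
  under eq_integral => x _ do rewrite gee0_abs ?lee_fin ?powR_ge0//.
  by rewrite -Lnorm_lty.
have fgf n x : (`|f x - g n x| <= `|f x|)%R.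
  have /andP[g0 gfx] := gf n x; rewrite ger0_norm ?subr_ge0// ger0_norm//.
  by rewrite lerBlDr lerDl.
have : \int[nu]_x h n x @[n --> \oo] --> \int[nu]_x (cst 0 x).
  apply: (dominated_cvg measurableT mh _ _ ifp) => //.
  - move=> x _; apply: cvg_EFin; first exact: nearW.
    apply/cvgr0Pnorm_le => eps eps0.
    have : (f x - g n x)%R @[n --> \oo] --> (0 : R)%R.
      by rewrite -(subrr (f x)); apply: cvgB; [exact: cvg_cst|exact: gcvg].
    move=> /cvgr0Pnorm_le/(_ (eps `^ p^-1)%R); rewrite powR_gt0// => /(_ isT).
    apply: filterS => n hn; rewrite /h /= ger0_norm ?powR_ge0//.
    rewrite [leRHS](_ : eps = (eps `^ p^-1) `^ p)%R; last first.
      by rewrite -powRrM mulVf ?gt_eqF// powRr1// ltW.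
    by apply: ge0_ler_powR; rewrite ?nnegrE ?(ltW p0) ?powR_ge0.
  - move=> n x _; rewrite gee0_abs ?lee_fin ?powR_ge0//.
    by apply: ge0_ler_powR; rewrite ?nnegrE ?(ltW p0).
rewrite integral0 => hcvg.
have ep0 : (0 < e `^ p)%R by rewrite powR_gt0.
have [n _ nP] : \forall n \near \oo, \int[nu]_x h n x < (e `^ p)%:E.
  apply: (hcvg [set z | z < (e `^ p)%:E]).
  by apply: open_nbhs_nbhs; split; [exact: open_ereal_lt_ereal|rewrite /= lte_fin].
exists (g n); first exact: gP.
by rewrite Lnorm_le ?(ltW e0)//; apply/ltW/nP => /=.
Qed.

Lemma ball_average_le_cst (x : X) r (h : X -> R) (c : R) : (0 < r)%R -> (0 <= c)%R ->
  mu.-integrable (ball x r) (EFin \o h) ->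
  (forall y, ball x r y -> (`|h y| <= c)%R) -> (`|ball_average r h x| <= c)%R.
Proof.
move=> r0 c0 ih hc; have mB := measurable_mball x r.
have b0 : (0 < fine (mu (ball x r)))%R.
  by rewrite fine_gt0// (measure_ball_gt0 dbl)// ltey_eq (measure_ball_fin dbl).
have mh : measurable_fun (ball x r) (EFin \o h) by case/integrableP: ih.
rewrite -lee_fin -abse_EFin -ball_averageE// averageE// abseM.
rewrite abse_EFin ger0_norm ?invr_ge0 ?(ltW b0)// lee_pdivrMl//.
apply: le_trans (le_abse_integral _ mB mh) _.
apply: (@le_trans _ _ (\int[mu]_(y in ball x r) c%:E)).
  by apply: ge0_le_integral => //; exact: measurableT_comp.
by rewrite integral_cst// -{1}(fineK (measure_ball_fin dbl x r)) muleC.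
Qed.

Lemma Lnorm_ball_le (h : X -> R) (c : R) (x0 : X) A : (0 < A)%R ->
  measurable_fun setT h -> (0 <= c)%R -> (forall x, `|h x| <= c)%R ->
  (forall x, ~ ball x0 A x -> h x = 0%R) ->
  N h <= (c * fine (nu (ball x0 A)) `^ p^-1)%:E.
Proof.
move=> A0 mh c0 hc h0; have mB := measurable_mball x0 A.
rewrite Lnorm_le//; last by rewrite mulr_ge0// powR_ge0.
rewrite powRM ?powR_ge0// -powRrM mulVf ?gt_eqF// powRr1 ?fine_ge0//.
apply: (@le_trans _ _ (\int[nu]_(x in ball x0 A) (c `^ p)%:E)).
  rewrite [leRHS]integral_mkcond; apply: ge0_le_integral => //.
  - exact: measurable_powR_norm.
  - by apply/(measurable_restrictT _ mB).
  - move=> x _; rewrite patchE; case: ifPn => [_|/negP xB].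
      by rewrite lee_fin ge0_ler_powR ?nnegrE ?(ltW p0).
    by rewrite h0 ?normr0 ?powR0 ?gt_eqF// => Bx; apply: xB; rewrite inE.
rewrite integral_cst// -[X in _ * X <= _]fineK ?EFinM//.
exact: (measure_ball_fin weighted_doubling).
Qed.

(** A Lipschitz function of bounded support differs from its average by at most
the radius times the Lipschitz constant, on a ball of finite measure. *)
Lemma averages_converge_lipschitz (g : X -> R) (L A : R) (x0 : X) :
  (0 <= L)%R -> (0 < A)%R ->
  (forall x y, `|g x - g y| <= L * mdist x y)%R ->
  (forall x, ~ ball x0 A x -> g x = 0%R) -> averages_converge g.
Proof.
move=> L0 A0 gL g0; have mg := measurable_lipschitz gL.
pose B := ball x0 (A + 1)%R; have mB : measurable B := measurable_mball _ _.
have A10 : (0 < A + 1)%R by rewrite addr_gt0.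
have NB h c := @Lnorm_ball_le h c x0 _ A10.
have c0 : (0 <= `|g x0| + L * A)%R by rewrite addr_ge0// mulr_ge0// ltW.
have gb x : (`|g x| <= `|g x0| + L * A)%R.
  have [/in_ball xA|nA] := pselect (ball x0 A x); last by rewrite g0// normr0.
  rewrite -(subrK (g x0) (g x)) (le_trans (ler_normD _ _))// addrC lerD2l distrC.
  by apply: le_trans (gL _ _) _; rewrite ler_wpM2l// ltW.
have gB x : ~ B x -> g x = 0%R.
  by move=> nB; apply: g0 => xA; apply: nB; apply: mball_subset xA; rewrite mdistxx; lra.
have Ng : N g < +oo by apply: le_lt_trans (NB _ _ mg c0 gb gB) (ltry _).
split => // e e0.
have V0 : (0 < L * fine (nu B) `^ p^-1 + 1)%R.
  by rewrite ltr_wpDl// mulr_ge0// powR_ge0.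
exists (Num.min 1 (e / (L * fine (nu B) `^ p^-1 + 1)))%R.
  by rewrite lt_min ltr01 divr_gt0.
move=> r /andP[r0]; rewrite lt_min => /andP[r1 re].
have ig x : mu.-integrable (ball x r) (EFin \o g).
  exact: Lp_ball_integrable.
have icst x (c : R) : mu.-integrable (ball x r) (EFin \o cst c).
  have mBx := measurable_mball x r; apply/integrableP; split.
    exact/measurable_EFinP/measurable_cst.
  have := integral_cst mu mBx `|c|%:E => /= ->.
  by rewrite -(fineK (measure_ball_fin dbl x r)) ltry.
have Avg_cst x (c : R) : ball_average r (cst c) x = c.
  have mBx := measurable_mball x r.
  apply: EFin_inj; rewrite -ball_averageE// averageE//.
  have := integral_cst mu mBx c%:E => /= ->.
  rewrite -[X in _ * (_ * X)](fineK (measure_ball_fin dbl x r)) -!EFinM.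
  rewrite mulrCA mulVf ?mulr1// gt_eqF// fine_gt0// (measure_ball_gt0 dbl)//.
  by rewrite ltey_eq (measure_ball_fin dbl).
have gA x : (`|g x - ball_average r g x| <= L * r)%R.
  rewrite -{1}(Avg_cst x (g x)) -(ball_averageB r0 (icst x (g x)) (ig x)).
  apply: ball_average_le_cst => //.
  - by rewrite mulr_ge0// ltW.
  - exact: (integrableB (measurable_mball x r) (icst x (g x)) (ig x)).
  - by move=> y /in_ball xy; apply: le_trans (gL _ _) _; rewrite ler_wpM2l// ltW.
apply: le_trans (NB (fun x => g x - ball_average r g x)%R (L * r)%R _ _ gA _) _.
- by apply: measurable_funB => //; exact: measurable_ball_average.
- by rewrite mulr_ge0// ltW.
- move=> x nB; rewrite gB// sub0r; apply/eqP; rewrite oppr_eq0 -normr_le0.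
  apply: ball_average_le_cst => // y /in_ball xy; rewrite g0 ?normr0// => /in_ball xA.
  apply: nB; apply/in_ball; have := metric_triangle x0 y x.
  by rewrite (metric_sym y x); lra.
rewrite lee_fin; move: re; rewrite ltr_pdivlMr// => /ltW; apply: le_trans.
have := powR_ge0 (fine (nu B)) p^-1; set V := (_ `^ _)%R => V0'.
by rewrite mulrDr mulr1 mulrCA mulrA mulrAC lerDl ltW.
Qed.

Let indic_lty (E : set X) (c : R) (x0 : X) A : measurable E -> E `<=` ball x0 A ->
  (0 < A)%R -> (0 <= c)%R -> N (fun x => c * \1_E x)%R < +oo.
Proof.
move=> mE EA A0 c0.
have mcE : measurable_fun setT (fun x => c * \1_E x : R)%R.
  by apply: measurable_funM => //; exact: measurable_indic.
apply: le_lt_trans (@Lnorm_ball_le _ _ x0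
  _ A0 mcE c0 _ _) (ltry _).
- move=> x; rewrite normrM (ger0_norm c0) ler_piMr// indicE.
  by case: (_ \in _); rewrite ?normr1// normr0.
- move=> x nA; have nE : ~ E x by move=> /EA.
  by rewrite indicE memNset// mulr0.
Qed.

(** The functions [min 1 (n * depth U)] are Lipschitz and increase to the indicator
of the open set [U]. *)
Lemma averages_converge_open (U : set X) (c : R) (x0 : X) A :
  open U -> U `<=` ball x0 A -> (0 < A)%R -> (0 <= c)%R ->
  averages_converge (fun x => c * \1_U x)%R.
Proof.
move=> oU UA A0 c0; have mU := open_measurable_borel oU.
pose g (n : nat) x : R := (c * Num.min 1 (n%:R * depth U x))%R.
apply: (averages_converge_mono (g := g)).
- by apply: measurable_funM => //; exact: measurable_indic.
- exact: indic_lty UA A0 c0.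
- move=> n; apply: (averages_converge_lipschitz (L := c * n%:R) (x0 := x0) (A := A)) => //.
  + by rewrite mulr_ge0.
  + move=> x y; rewrite /g -mulrBr normrM (ger0_norm c0) -mulrA ler_wpM2l//.
    apply: (@le_trans _ _ `|n%:R * depth U x - n%:R * depth U y|%R).
      have minL (a b : R) : (`|Num.min 1 a - Num.min 1 b| <= `|a - b|)%R.
        rewrite ler_norml; have := ler_norm (a - b); have := ler_norm (b - a).
        by rewrite distrC; case: (leP 1%R a); case: (leP 1%R b); lra.
      exact: minL.
    by rewrite -mulrBr normrM ger0_norm// ler_wpM2l//; exact: depth_lipschitz.
  + move=> x nA; rewrite /g depth_out ?mulr0; last by move/UA.
    by rewrite min_r ?mulr0.
- move=> n x; rewrite /g indicE; case: (boolP (x \in U)) => [/set_mem xU|/negP xU].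
    rewrite mulr_ge0 ?le_min ?ler01 ?mulr_ge0 ?depth_ge0//= mulr1 ler_piMr//.
    by rewrite ge_min lexx.
  rewrite depth_out ?mulr0; last by move=> Ux; apply: xU; rewrite inE.
  by rewrite min_r// mulr0 lexx.
- move=> x; rewrite /g indicE.
  case: (boolP (x \in U)) => [/set_mem xU|/negP xU]; last first.
    rewrite depth_out; last by move=> Ux; apply: xU; rewrite inE.
    by under eq_fun do rewrite mulr0 min_r// mulr0; rewrite mulr0; exact: cvg_cst.
  rewrite mulr1; apply: cvg_near_cst; near=> n; rewrite min_l ?mulr1//.
  rewrite -ler_pdivrMr ?depth_gt0// mul1r; apply/ltW.
  by near: n; exact: nbhs_infty_gtr.
Unshelve. all: by end_near. Qed.

Lemma averages_converge0 : averages_converge (cst 0%R).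
Proof.
apply: (averages_converge_lipschitz (L := 0) (A := 1) (x0 := point)) => // x y.
by rewrite subrr normr0 mul0r.
Qed.

Lemma averages_convergeD (f g : X -> R) : averages_converge f ->
  averages_converge g -> averages_converge (fun x => f x + g x)%R.
Proof.
move=> Qf Qg; have := averages_convergeB Qf (averages_convergeB averages_converge0 Qg).
by congr averages_converge; apply/funext => x; rewrite /= sub0r opprK.
Qed.

(** Open sets form a generating pi-system, and [averages_converge] is stable under
differences and bounded increasing limits. The intersection with a ball keeps
the norms of all indicators finite, complements included. *)
Lemma averages_converge_indic (E : set X) : measurable E ->
  forall (c : R) (x0 : X) A, (0 < A)%R -> (0 <= c)%R ->
  averages_converge (fun x => c * \1_(E `&` ball x0 A) x)%R.
Proof.
rewrite borel_measurableE; move: E.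
apply: (@dynkin_induction _ X (@open X)).
- exact: borel_measurableE.
- by move=> U V; exact: openI.
- move=> c x0 A A0 c0; rewrite setTI.
  by apply: (averages_converge_open (x0 := x0) (A := A)) => //; exact: open_mball.
- move=> U oU c x0 A A0 c0.
  apply: (averages_converge_open (x0 := x0) (A := A)) => //.
  exact/openI/open_mball.
- move=> E mE QE c x0 A A0 c0.
  rewrite (_ : (fun _ => _) = (fun x => c * \1_([set: X] `&` ball x0 A) x -
      c * \1_(E `&` ball x0 A) x)%R); last first.
    apply/funext => x; rewrite -mulrBr; congr (_ * _)%R.
    rewrite !indicE !in_setI in_setC in_setT.
    by case: (x \in E); case: (x \in (ball x0 A : set X)); rewrite /= ?subrr ?subr0.
  apply: averages_convergeB; last exact: QE.
  rewrite setTI.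
  by apply: (averages_converge_open (x0 := x0) (A := A)) => //; exact: open_mball.
- move=> F mF tF QF c x0 A A0 c0.
  have mB := measurable_mball x0 A.
  have mUF : measurable (\bigcup_k F k) by exact: bigcup_measurable.
  pose g n x : R := (c * \1_((\bigcup_(i < n) F i) `&` ball x0 A) x)%R.
  apply: (averages_converge_mono (g := g)).
  + apply: measurable_funM => //; apply: measurable_indic; exact: measurableI.
  + by apply: (indic_lty (x0 := x0) (A := A)) => //; exact: measurableI.
  + elim=> [|n IH].
      rewrite (_ : g 0%N = cst 0%R); first exact: averages_converge0.
      by apply/funext => x; rewrite /g indicE memNset ?mulr0// => -[[i]].
    rewrite (_ : g n.+1 = fun x => g n x + c * \1_(F n `&` ball x0 A) x)%R; last first.
      apply/funext => x; rewrite /g -mulrDr; congr (_ * _)%R.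
      rewrite !indicE !in_setI.
      case: (x \in (ball x0 A : set X)); rewrite ?andbF ?addr0// !andbT.
      have -> : (x \in \bigcup_(i < n.+1) F i) = (x \in \bigcup_(i < n) F i) || (x \in F n).
        apply/idP/orP; rewrite !inE.
          move=> [i /=]; rewrite ltnS leq_eqVlt => /predU1P[->|ni Fi]; first by right.
          by left; exists i.
        move=> [[i /= ni Fi]|Fn]; last by exists n => /=.
        by exists i => //=; exact: ltnW.
      case: (boolP (x \in F n)); last by rewrite orbF addr0.
      move=> /set_mem Fn; rewrite orbT memNset ?add0r// => -[i /= ni Fi].
      have := tF i n I I (ex_intro _ x (conj Fi Fn)).
      by move=> ein; rewrite ein ltnn in ni.
    by apply: averages_convergeD => //; exact: QF.
  + move=> n x; rewrite /g mulr_ge0//= ler_wpM2l// !indicE ler_nat.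
    case: (boolP (x \in _)) => // /set_mem[[i /= _ Fi] Bx].
    by rewrite mem_set//; split => //; exists i.
  + move=> x; rewrite /g; apply: cvgMr.
    have [[[k _ Fk] Bx]|nx] := pselect ((\bigcup_k F k `&` ball x0 A) x).
      apply: cvg_near_cst; near=> n; rewrite !indicE !mem_set//.
        by split => //; exists k.
      split => //; exists k => //=; near: n; exact: nbhs_infty_gt.
    apply: cvg_near_cst; apply: nearW => n; rewrite !indicE !memNset//.
    by move=> [[k _ Fk] Bx]; apply: nx; split => //; exists k.
Unshelve. all: by end_near. Qed.

Import HBNNSimple.

(** Approximation from below by simple functions cut off to growing balls. *)
Lemma averages_converge_nneg (f : X -> R) : measurable_fun setT f ->
  (forall x, 0 <= f x)%R -> N f < +oo -> averages_converge f.
Proof.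
move=> mf f0 Nf; pose x0 : X := point.
have mfE : measurable_fun setT (EFin \o f) by exact/measurable_EFinP.
pose h := nnsfun_approx measurableT mfE.
have fE0 x : setT x -> 0 <= (EFin \o f) x by rewrite /= lee_fin.
pose g n x : R := (h n x * \1_(ball x0 n.+1%:R) x)%R.
apply: (averages_converge_mono (g := g)) => //.
- move=> n.
  have -> : g n = fun x => (\sum_(r <- finmap.enum_fset (fset_set (range (h n))))
      r * \1_(h n @^-1` [set r] `&` ball x0 n.+1%:R) x)%R.
    apply/funext => x; rewrite /g fimfunE fsbig_finite//= mulr_suml.
    by apply: eq_bigr => r _; rewrite -mulrA indicI.
  have : forall r, r \in finmap.enum_fset (fset_set (range (h n))) -> (0 <= r)%R.
    by move=> r; rewrite in_fset_set// => /set_mem[x _ <-].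
  elim: (finmap.enum_fset (fset_set (range (h n)))) => [|r s IH] s0.
    by under eq_fun do rewrite big_nil; exact: averages_converge0.
  under eq_fun do rewrite big_cons; apply: averages_convergeD.
    by apply: averages_converge_indic => //; apply: s0; rewrite inE eqxx.
  by apply: IH => t ts; apply: s0; rewrite inE ts orbT.
- move=> n x; rewrite /g mulr_ge0//=.
  apply: (@le_trans _ _ (h n x)).
    by rewrite ler_piMr// indicE; case: (_ \in _).
  by rewrite -lee_fin /h nnsfun_approxE; exact: le_approx.
- move=> x; rewrite /g -[X in _ --> X]mulr1; apply: cvgM.
    have := cvg_nnsfun_approx measurableT mfE fE0 (I : setT x).
    by move=> /fine_cvgP[_].
  apply: cvg_near_cst; near=> n; rewrite indicE mem_set//; apply/in_ball.
  apply: (@lt_trans _ _ n%:R); last by rewrite ltr_nat.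
  by near: n; exact: nbhs_infty_gtr.
Unshelve. all: by end_near. Qed.

Lemma averages_converge_Lp (f : X -> R) : measurable_fun setT f -> N f < +oo ->
  averages_converge f.
Proof.
move=> mf Nf.
have pos (h : X -> R) : measurable_fun setT h -> N h < +oo ->
    averages_converge (fun x => Num.max (h x) 0)%R.
  move=> mh Nh.
  have mh0 : measurable_fun setT (fun x => Num.max (h x) 0)%R.
    exact: measurable_maxr.
  apply: averages_converge_nneg => //; first by move=> x; rewrite le_max lexx orbT.
  apply: le_lt_trans Nh; apply: Lnorm_mono => // x.
  by case: (leP (h x) 0)%R => hx; rewrite ?normr0.
have mNf : measurable_fun setT (fun x => - f x)%R by exact: measurableT_comp.
have NNf : N (fun x => - f x)%R < +oo.
  by apply: le_lt_trans Nf; apply: Lnorm_mono => // x; rewrite normrN.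
have := averages_convergeB (pos _ mf Nf) (pos _ mNf NNf).
congr averages_converge; apply/funext => x.
by case: (leP (f x) 0%R); case: (leP (- f x)%R 0%R); lra.
Qed.

(** * The compactness criterion *)

Local Notation Lp := (LspaceType nu (lee1_lt p1)).
Variables (K : set Lp) (x0 : X).

Let mL (f : Lp) : measurable_fun [set: X] (f : X -> R) := measurable_Lspace f.
Let Nlty (f : Lp) : N f < +oo := Lspace_lty f.

Local Notation tail A f := (fun x => f x * \1_(~` ball x0 A) x)%R.

Let mtail A (f : X -> R) : measurable_fun setT f -> measurable_fun setT (tail A f).
Proof.
move=> mf; apply: measurable_funM => //; apply: measurable_indic.
exact/measurableC/measurable_mball.
Qed.

Lemma Lnorm_tail_small (f : X -> R) (e : R) : measurable_fun setT f -> N f < +oo ->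
  (0 < e)%R -> exists A0 : R, forall A, (A0 <= A)%R -> N (tail A f) <= e%:E.
Proof.
move=> mf Nf e0; pose h n x := (`|tail n%:R f x| `^ p)%:E.
have mh n : measurable_fun setT (h n) by apply: measurable_powR_norm; exact: mtail.
have ifp : nu.-integrable setT (fun x => (`|f x| `^ p)%:E).
  apply/integrableP; split; first exact: measurable_powR_norm.
  under eq_integral => x _ do rewrite gee0_abs ?lee_fin ?powR_ge0//.
  by rewrite -Lnorm_lty.
have : \int[nu]_x h n x @[n --> \oo] --> \int[nu]_x (cst 0 x).
  apply: (dominated_cvg measurableT mh _ _ ifp) => //.
  - move=> x _; apply: cvg_near_cst; near=> n; rewrite /h indicE memNset.
      by rewrite mulr0 normr0 powR0// gt_eqF.
    apply; apply/in_ball; near: n; exact: nbhs_infty_gtr.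
  - move=> n x _; rewrite gee0_abs ?lee_fin ?powR_ge0//.
    apply: ge0_ler_powR; rewrite ?nnegrE ?(ltW p0)//.
    by rewrite normrM ler_piMr// indicE; case: (_ \in _); rewrite ?normr1// normr0.
rewrite integral0 => /nneg_cvg0P/(_ (e `^ p)%R); rewrite powR_gt0// => hcvg.
have [|//|n _ nP] := hcvg _.
  by move=> n; apply: integral_ge0 => x _; rewrite lee_fin powR_ge0.
exists n%:R => A nA; apply: (@le_trans _ _ (N (tail n%:R f))).
  apply: Lnorm_mono => //; [exact: mtail..|] => x.
  rewrite !normrM ler_wpM2l// !indicE !ger0_norm// ler_nat.
  case: (boolP (x \in ~` ball x0 A)) => // /set_mem nxA.
  rewrite mem_set// => xn; apply: nxA; apply: mball_subset xn.
  by rewrite mdistxx add0r.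
by rewrite Lnorm_le ?(ltW e0)//; exact: (nP n (leqnn n)).
Unshelve. all: by end_near. Qed.

Let Lnorm_le_sub (f g : X -> R) : measurable_fun setT f -> measurable_fun setT g ->
  N g <= N f + N (fun x => f x - g x)%R.
Proof.
move=> mf mg; have := Lnorm_sub_le nu p1 mf (measurable_funB mf mg).
by apply: le_trans; rewrite le_eqVlt; apply/orP; left; apply/eqP;
  apply: eq_Lnorm => x /=; rewrite opprB addrC subrK.
Qed.

(* The form in which local bounds are fed to [compact_near_coveringP]. *)
Let near_ball (f : Lp) (e : R) (I : Type) (F : set_system I) (FF : Filter F)
    (B : set I) (P : I -> Lp -> Prop) : (0 < e)%R -> F B ->
  (forall (g : Lp) i, N (fun x => f x - g x)%R <= e%:E -> B i -> P i g) ->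
  \forall g \near f & i \near F, P i g.
Proof.
move=> e0 FB H; exists (ball f e, B); first by split => //=; exact: nbhsx_ballx.
move=> [g i]/= []; rewrite ballEmdist/= => fg Bi; apply: H => //.
by rewrite -Lspace_mdistE lee_fin ltW.
Qed.

(** A bound that holds near every element of a compact set holds uniformly on it. *)
Lemma compact_sup_Lnorm : compact (closure K) ->
  sup_nonneg [set N f | f in K] < +oo.
Proof.
move=> /compact_near_coveringP cK.
have H f : closure K f -> \forall g \near f & n \near \oo, N (g : Lp) <= n%:R%:E.
  move=> _; have [c c0 Nc] := Lnorm_finE (Nlty f).
  apply: (@near_ball f 1%R _ _ _ [set n | (c + 1 <= n%:R)%R]) => //.
    exact: nbhs_infty_ger.
  move=> g n fg cn; apply: le_trans (Lnorm_le_sub (mL f) (mL g)) _.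
  by rewrite Nc; apply: le_trans (leeD (lexx _) fg) _; rewrite lee_fin.
have [n _ nP] := cK _ _ _ _ H.
apply: (@le_lt_trans _ _ n%:R%:E); last exact: ltry.
apply/sup_nonneg_leP; first by rewrite lee_fin.
by move=> _ [f Kf <-]; apply: (nP n (leqnn n)); exact: subset_closure.
Qed.

Lemma compact_tail : compact (closure K) ->
  sup_nonneg [set 'N[nu]_p%:E [(fun x => (f x * \1_(~` ball x0 A) x)%:E)]
             | f in K] @[A --> +oo%R] --> 0.
Proof.
move=> /compact_near_coveringP cK; apply/nneg_cvg0P => [?|].
  exact: sup_nonneg_ge0.
move=> e e0; have e2 : (0 < e / 2)%R by rewrite divr_gt0.
have H f : closure K f ->
    \forall g \near f & A \near +oo%R, N (tail A (g : Lp)) <= e%:E.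
  move=> _; have [A0 A0P] := Lnorm_tail_small (mL f) (Nlty f) e2.
  apply: (@near_ball f (e / 2)%R _ _ _ [set A | (A0 <= A)%R]) => //.
    exact/nbhs_pinfty_ge/num_real.
  move=> g A fg /A0P fA.
  apply: le_trans (Lnorm_le_sub (mtail A (mL f)) (mtail A (mL g))) _.
  rewrite [e in leRHS]splitr EFinD; apply: leeD => //; apply: le_trans fg.
  apply: Lnorm_mono => //.
  - by apply: measurable_funB; exact: mtail.
  - exact: measurable_funB.
  move=> x; rewrite -mulrBl normrM ler_piMr// indicE.
  by case: (_ \in _); rewrite ?normr1// normr0.
apply: filterS (cK _ _ _ _ H) => A AP; apply/sup_nonneg_leP; first by rewrite lee_fin ltW.
by move=> _ [f Kf <-]; apply: AP; exact: subset_closure.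
Qed.

Let avg_defectE r (f : Lp) : (0 < r)%R ->
  'N[nu]_p%:E [(fun x => (f x)%:E - average mu (EFin \o f) (ball x r))] =
  N (fun x => f x - ball_average r f x)%R.
Proof.
move=> r0; apply: eq_Lnorm => x; rewrite ball_averageE//.
exact: Lp_ball_integrable.
Qed.

Lemma compact_averages : compact (closure K) ->
  sup_nonneg [set 'N[nu]_p%:E [(fun x => (f x)%:E -
                                 average mu (EFin \o f) (ball x r))]
             | f in K] @[r --> 0%R^'+] --> 0.
Proof.
move=> /compact_near_coveringP cK; apply/nneg_cvg0P => [?|].
  exact: sup_nonneg_ge0.
move=> e e0.
have [C C0 CP] := ball_average_bounded.
pose e1 := (e / (2 + C))%R.
have C20 : (0 < 2 + C)%R by rewrite addr_gt0.
have e10 : (0 < e1)%R by rewrite divr_gt0.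
have H f : closure K f -> \forall g \near f & r \near 0%R^'+,
    N (fun x => (g : Lp) x - ball_average r g x)%R <= e%:E.
  move=> _.
  have [_ _ fP] := averages_converge_Lp (mL f) (Nlty f).
  have [r0 r00 r0P] := fP _ e10.
  apply: (@near_ball f e1 _ _ _ [set r | (0 < r < r0)%R]) => //.
    by near=> r; apply/andP; split; near: r; [exact: nbhs_right_gt|exact: nbhs_right_lt].
  move=> g r fg /andP[rp rr].
  have fr := r0P r ltac:(by rewrite rp).
  have mfA := measurable_ball_average rp (mL f) (Nlty f).
  have mgA := measurable_ball_average rp (mL g) (Nlty g).
  apply: le_trans (Lnorm_sub_triangle nu p1 (mL g) (mL f) mgA) _.
  apply: le_trans (_ : _ <= e1%:E + (e1%:E + (C * e1)%:E)) _; last first.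
    rewrite -!EFinD lee_fin /e1 le_eqVlt; apply/orP; left; apply/eqP.
  by field; rewrite gt_eqF.
  apply: leeD; first by rewrite Lnorm_subC.
  apply: le_trans (Lnorm_sub_triangle nu p1 (mL f) mfA mgA) _.
  apply: leeD => //.
  rewrite (_ : EFin \o _ = EFin \o ball_average r (fun x => f x - g x)%R); last first.
    by apply/funext => x /=; rewrite ball_average_sub.
  apply: (@le_trans _ _ (C%:E * N (fun x => f x - g x)%R)).
    by apply: CP => //; [exact: measurable_funB|exact: Lnorm_sub_lty].
  by rewrite EFinM lee_wpmul2l// lee_fin ltW.
near=> r; apply/sup_nonneg_leP; first by rewrite lee_fin ltW.
have r0 : (0 < r)%R by near: r; exact: nbhs_right_gt.
move=> _ [f Kf <-]; rewrite avg_defectE//.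
suff : forall f, closure K f -> N (fun x => (f : Lp) x - ball_average r f x)%R <= e%:E.
  by apply; exact: subset_closure.
near: r; exact: cK _ _ _ _ H.
Unshelve. all: by end_near. Qed.

Lemma ball_average_bound (x : X) r (c : R) : (0 < r)%R -> (0 <= c)%R ->
  exists2 b : R, (0 <= b)%R & forall f : X -> R, measurable_fun setT f ->
    N f <= c%:E -> (`|ball_average r f x| <= b)%R.
Proof.
move=> r0 c0; pose t := (M * ((fine (nu (ball x r)))^-1 * c `^ p))%R.
have t0 : (0 <= t)%R.
  by rewrite mulr_ge0 ?(ltW M0)// mulr_ge0 ?powR_ge0// invr_ge0 fine_ge0.
exists (t `^ p^-1)%R; first exact: powR_ge0.
move=> f mf Nf; have fi : mu.-integrable (ball x r) (EFin \o f).
  apply: Lp_ball_integrable => //.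
  exact: le_lt_trans Nf (ltry _).
have := ball_average_powR_le r0 mf fi => h.
have {}h : (`|ball_average r f x| `^ p <= t)%R.
  rewrite -lee_fin; apply: (le_trans h); rewrite /t !EFinM.
  rewrite lee_wpmul2l ?lee_fin ?(ltW M0)// lee_wpmul2l ?lee_fin ?invr_ge0 ?fine_ge0//.
  move: Nf; rewrite Lnorm_le//; apply: le_trans; apply: ge0_subset_integral => //.
  - exact: measurable_mball.
  - exact: measurable_powR_norm.
have ip0 : (0 <= p^-1)%R by rewrite invr_ge0 ltW.
have := ge0_ler_powR ip0 _ _ h; rewrite !nnegrE powR_ge0 t0 => /(_ isT isT).
by rewrite -powRrM divff ?gt_eqF// powRr1.
Qed.

(** On a ball, finitely many values of the averages determine them up to [e]:
by compactness the equicontinuity is uniform, and a finite net of points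
suffices. *)
Lemma ball_averages_colouring A r (c e : R) : (0 < A)%R -> (0 < r)%R -> (0 <= c)%R ->
  (0 < e)%R -> (forall f : Lp, K f -> N f <= c%:E) ->
  exists (T : finType) (k : Lp -> T), forall f g : Lp, K f -> K g -> k f = k g ->
    forall x, ball x0 A x -> (`|ball_average r f x - ball_average r g x| <= e)%R.
Proof.
move=> A0 r0 c0 e0 Kc; have e3 : (0 < e / 3)%R by rewrite divr_gt0.
have e6 : (0 < e / 3 / 2)%R by rewrite divr_gt0.
have Kc' (f : Lp) : K f -> \int[nu]_x (`|f x| `^ p)%:E <= (c `^ p + 1)%:E.
  move=> Kf; apply: (@le_trans _ _ (c `^ p)%:E); last by rewrite lee_fin lerDl.
  by rewrite -Lnorm_le//; exact: Kc.
have L0 : (0 < c `^ p + 1)%R by rewrite ltr_wpDl// powR_ge0.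
have /compact_near_coveringP cB := compact_closure_ball (x0 := x0) dbl A0.
have H x : closure (ball x0 A : set X) x -> \forall x' \near x & s \near 0%R^'+,
    forall y (f : Lp), (mdist x' y < s)%R -> K f ->
    (`|ball_average r f x' - ball_average r f y| <= e / 3)%R.
  move=> _.
  have [s s0 sP] := ball_average_equicontinuous x r0 L0 e6.
  have s2 : (0 < s / 2)%R by rewrite divr_gt0.
  exists (ball x (s / 2)%R, [set t | (t < s / 2)%R]).
    by split => /=; [exact: nbhsx_ballx|exact: nbhs_right_lt].
  move=> [x' t]/= []; rewrite ballEmdist/= => xx' ts y f x'y Kf.
  have h1 := sP x' f ltac:(by lra) (mL f) (Kc' f Kf).
  have xy : (mdist x y < s)%R.
    rewrite (le_lt_trans (metric_triangle _ x' _))// [ltRHS]splitr ltrD//.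
    exact: lt_trans x'y ts.
  have h2 := sP y f xy (mL f) (Kc' f Kf).
  rewrite (le_trans (ler_distD (ball_average r f x) _ _))// [leRHS]splitr lerD//.
  by rewrite distrC.
have [s [s0 sP]] : exists s : R, (0 < s)%R /\ forall x, ball x0 A x ->
    forall y (f : Lp), (mdist x y < s)%R -> K f ->
    (`|ball_average r f x - ball_average r f y| <= e / 3)%R.
  near (0 : R)%R^'+ => s; exists s; split; first by near: s; exact: nbhs_right_gt.
  suff sub : closure (ball x0 A : set X) `<=` [set x | forall y (f : Lp),
      (mdist x y < s)%R -> K f -> (`|ball_average r f x - ball_average r f y| <= e / 3)%R].
    by move=> x xB; apply: sub; exact: subset_closure.
  by near: s; exact: cB _ _ _ _ H.
have [t tP] := ball_finite_net dbl x0 A0 s0.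
have /choice[b bP] : forall y : X, exists b : R, (0 <= b)%R /\ forall f : Lp, K f ->
    (`|ball_average r f y| <= b)%R.
  move=> y; have [b b0 bP] := ball_average_bound y r0 c0.
  by exists b; split => // f Kf; apply: bP => //; exact: Kc.
(* The colour of [f] lists its averages at the net points, rounded to multiples of
[e / 3]; [m] bounds the roundings, so that there are finitely many colours. *)
pose m := (\max_(i < size t) Num.truncn ((2 * b (nth x0 t i)) / (e / 3)))%N.
pose col (f : Lp) y := Num.truncn ((ball_average r f y + b y) / (e / 3)).
exists {ffun 'I_(size t) -> 'I_m.+1}, (fun f : Lp =>
  [ffun i : 'I_(size t) => inord (col f (nth x0 t i))]).
move=> f g Kf Kg /ffunP fg x xB; have [y yt yx] := tP x xB.
have ilt : (index y t < size t)%N by rewrite index_mem.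
have colm (h : Lp) : K h -> (col h y <= m)%N.
  move=> Kh; apply: (@leq_trans (Num.truncn ((2 * b y) / (e / 3)))).
    apply: le_truncn; rewrite ler_wpM2r ?invr_ge0 ?(ltW e3)//.
    by have := le_trans (ler_norm _) ((bP y).2 h Kh); lra.
  have := @leq_bigmax _ (fun i : 'I_(size t) =>
    Num.truncn ((2 * b (nth x0 t i)) / (e / 3))) (Ordinal ilt).
  by rewrite /= nth_index.
have col_eq : col f y = col g y.
  have := fg (Ordinal ilt); rewrite !ffunE /= nth_index// => /(congr1 val)/=.
  by rewrite !inordK ?ltnS ?colm.
have col_itv (h : Lp) : K h -> ((col h y)%:R * (e / 3) <=
    ball_average r h y + b y < (col h y).+1%:R * (e / 3))%R.
  move=> Kh; rewrite -ler_pdivlMr// -ltr_pdivrMr//; apply: truncn_itv.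
  rewrite divr_ge0 ?(ltW e3)//.
  by have := (bP y).2 h Kh; rewrite ler_norml => /andP[]; lra.
have := col_itv f Kf; have := col_itv g Kg; rewrite -col_eq => /andP[g1 g2] /andP[f1 f2].
have xy : (mdist x y < s)%R by rewrite metric_sym.
have := sP x xB y f xy Kf; have := sP x xB y g xy Kg.
move: g2 f2; rewrite -natr1 mulrDl mul1r.
by rewrite !ler_norml; lra.
Unshelve. all: by end_near. Qed.

(** The difference [f - g] splits into the two parts outside of the ball, small by
the tail condition, the two differences with the averages, and the difference
of the averages on the ball, small for [f] and [g] of the same colour. *)
Lemma totally_bounded_criterion :
  sup_nonneg [set N f | f in K] < +oo ->
  sup_nonneg [set 'N[nu]_p%:E [(fun x => (f x * \1_(~` ball x0 A) x)%:E)]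
             | f in K] @[A --> +oo%R] --> 0 ->
  sup_nonneg [set 'N[nu]_p%:E [(fun x => (f x)%:E -
                                 average mu (EFin \o f) (ball x r))]
             | f in K] @[r --> 0%R^'+] --> 0 ->
  totally_bounded (M := Lp) K.
Proof.
move=> Ka Kb Kc e e0; pose e1 := (e / 6)%R.
have e10 : (0 < e1)%R by rewrite divr_gt0.
have [c c0 NKc] : exists2 c : R, (0 <= c)%R & forall f : Lp, K f -> N f <= c%:E.
  exists (fine (sup_nonneg [set N f | f in K])); first by rewrite fine_ge0// sup_nonneg_ge0.
  move=> f Kf; rewrite fineK; last by rewrite ge0_fin_numE// sup_nonneg_ge0.
  by apply: ereal_sup_ubound; right; exists f.
have [A [A0 AP]] : exists A : R, (0 < A)%R /\ forall f : Lp, K f -> N (tail A f) <= e1%:E.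
  have FF : Filter (pinfty_nbhs R) by exact: _.
  have h := (nneg_cvg0P FF (fun A => sup_nonneg_ge0 _)).1 Kb e1 e10.
  have {}h : \forall A \near (pinfty_nbhs R), forall f : Lp, K f -> N (tail A f) <= e1%:E.
    apply: filterS h => A hA f Kf; apply: le_trans hA.
    by apply: ereal_sup_ubound; right; exists f.
  near (pinfty_nbhs R) => A; exists A; split.
    by near: A; exact/nbhs_pinfty_gt/num_real.
  by near: A; exact: h.
have [r [r0 rP]] : exists r : R, (0 < r)%R /\ forall f : Lp, K f ->
    N (fun x => f x - ball_average r f x)%R <= e1%:E.
  have FF : Filter (0 : R)%R^'+ by exact: _.
  have h := (nneg_cvg0P FF (fun r => sup_nonneg_ge0 _)).1 Kc e1 e10.
  have {}h : \forall r \near (0 : R)%R^'+, (0 < r)%R -> forall f : Lp, K f ->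
      N (fun x => f x - ball_average r f x)%R <= e1%:E.
    apply: filterS h => r hr r0 f Kf; rewrite -avg_defectE//; apply: le_trans hr.
    by apply: ereal_sup_ubound; right; exists f.
  near (0 : R)%R^'+ => r; exists r.
  have r0 : (0 < r)%R by near: r; exact: nbhs_right_gt.
  by split => //; move: r0; near: r; exact: h.
pose V := (fine (nu (ball x0 A)) `^ p^-1)%R.
have V0 : (0 <= V)%R by exact: powR_ge0.
have V10 : (0 < V + 1)%R by rewrite ltr_wpDl.
have e20 : (0 < e1 / (V + 1))%R by rewrite divr_gt0.
have [T [k kP]] := ball_averages_colouring A0 r0 c0 e20 NKc.
exists T, k => f g Kf Kg kfg; rewrite -lte_fin Lspace_mdistE.
have mf := mL f; have mg := mL g.
have mfA := measurable_ball_average r0 mf (Nlty f).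
have mgA := measurable_ball_average r0 mg (Nlty g).
have mB : measurable (ball x0 A) := measurable_mball x0 A.
pose loc (h : X -> R) x := (h x * \1_(ball x0 A) x)%R.
have mloc h : measurable_fun setT h -> measurable_fun setT (loc h).
  by move=> mh; apply: measurable_funM => //; exact: measurable_indic.
have locN h : measurable_fun setT h -> N (loc h) <= N h.
  move=> mh; apply: Lnorm_mono => //; first exact: mloc.
  move=> x; rewrite normrM ler_piMr// indicE.
  by case: (_ \in _); rewrite ?normr1// normr0.
have h1 : N (fun x => f x - ball_average r f x)%R <= e1%:E by exact: rP.
have h2 : N (fun x => g x - ball_average r g x)%R <= e1%:E by exact: rP.
have h3 : N (loc (fun x => ball_average r f x - ball_average r g x)%R) <= e1%:E.
  apply: le_trans (Lnorm_ball_le (c := (e1 / (V + 1))%R) (x0 := x0) A0 _ _ _ _) _.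
  - by apply: mloc; exact: measurable_funB.
  - exact: ltW.
  - move=> x; rewrite /loc indicE; case: (boolP (x \in _)) => [/set_mem xB|_].
      by rewrite mulr1; exact: kP.
    by rewrite mulr0 normr0 ltW.
  - by move=> x nB; rewrite /loc indicE memNset// mulr0.
  rewrite lee_fin -/V mulrAC ler_pdivrMr// ler_wpM2l ?(ltW e10)//.
  by rewrite lerDl.
pose a x := (f x - ball_average r f x)%R; pose b x := (g x - ball_average r g x)%R.
have ma : measurable_fun setT a by exact: measurable_funB.
have mb : measurable_fun setT b by exact: measurable_funB.
have := Lnorm_sub_le nu p1 (measurable_funB (mtail A mf) (mtail A mg))
  (measurable_funB (measurable_funB (mloc _ mb) (mloc _ ma))
     (mloc _ (measurable_funB mfA mgA))) => hh.
rewrite (_ : 'N[nu]_p%:E[_] = N (fun x => (tail A f x - tail A g x) -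
   ((loc b x - loc a x) -
    loc (fun x => ball_average r f x - ball_average r g x) x))%R); last first.
  apply: eq_Lnorm => x; rewrite /= /loc /a /b; congr EFin.
  have -> : (\1_(~` ball x0 A) x = 1 - \1_(ball x0 A) x :> R)%R.
    by rewrite !indicE in_setC; case: (_ \in _); rewrite ?subrr ?subr0.
  by ring.
apply: (le_lt_trans hh).
apply: (@le_lt_trans _ _ ((e1 + e1) + ((e1 + e1) + e1))%:E).
  rewrite !EFinD; apply: leeD.
    apply: le_trans (Lnorm_sub_le nu p1 (mtail A mf) (mtail A mg)) _.
    by apply: leeD; exact: AP.
  apply: le_trans (Lnorm_sub_le nu p1 (measurable_funB (mloc _ mb) (mloc _ ma))
    (mloc _ (measurable_funB mfA mgA))) _.
  apply: leeD => //.
  apply: le_trans (Lnorm_sub_le nu p1 (mloc _ mb) (mloc _ ma)) _.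
  by apply: leeD; [exact: le_trans (locN b mb) h2|exact: le_trans (locN a ma) h1].
by rewrite lte_fin /e1; lra.
Unshelve. all: by end_near. Qed.

End WeightedAverages.

Local Open Scope ereal_scope.

Theorem theorem1p13 (d : measure_display) (R : realType)
    (X : completeBorelMetricType d R) (mu : {measure set X -> \bar R})
    (mu_doubling : doubling mu) (mu_cont : metrically_continuous mu)
    (x0 : X) (p : R) (p1 : (1 < p)%R) (w : {mfun X >-> \bar R})
    (w_weight : is_weight mu w) (w_Ap : Muckenhoupt mu p (metric_balls X) w)
    (K : set (weighted_Lspace mu w p1)) :
  let nu := weighted_measure mu w in
  compact (closure K) <->
  [/\ sup_nonneg [set 'N[nu]_p%:E [EFin \o f] | f in K] < +oo,
      sup_nonneg [set 'N[nu]_p%:E [(fun x => (f x * \1_(~` ball x0 A) x)%:E)]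
                 | f in K]
        @[A --> +oo%R] --> 0
    & sup_nonneg [set 'N[nu]_p%:E [(fun x => (f x)%:E -
                                     average mu (EFin \o f) (ball x r))]
                 | f in K] @[r --> 0%R^'+] --> 0].
Proof.
move=> nu.
have [v [mv v0 wv]] := weight_real_version w_weight.
have [M M0 Ap] := Muckenhoupt_ball mu_doubling p1 w_Ap mv v0 wv.
have nuE A : measurable A -> nu A = \int[mu]_(x in A) (v x)%:E.
  exact: weighted_measureE.
split=> [cK|[Ka Kb Kc]].
  split.
  - exact: compact_sup_Lnorm.
  - exact: (compact_tail (nu := nu)).
  - exact: (compact_averages mu_doubling M0 mv v0 nuE Ap mu_cont).
apply: totally_bounded_compact; first exact: Lspace_small_filters_cvg.
exact: (totally_bounded_criterion mu_doubling M0 mv v0 nuE Ap mu_cont Ka Kb Kc).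
Qed.
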